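(* Let $K\ge1$, $K'\ge0$, and let $f=h+\overline{g}$ (with $h,g$ analytic in $\mathbb{D}$, $g(0)=0$) be a $(K,K')$-elliptic harmonic mapping in $\mathbb{D}$ with $f(0)=0$, $\lambda_f(0)=1$ and $\lambda_f(z)\le\lambda$ for all $z\in\mathbb{D}$. Then $f$ is univalent in the disk $\mathbb{D}_{r_1}$, where $$r_1=\frac{1}{1+K\lambda+\frac{2(K'-1)}{K\lambda+\sqrt{K^2\lambda^2+4K'}}},$$ and $f(\mathbb{D}_{r_1})$ contains the disk $\mathbb{D}_{\sigma_1}$, where $$\sigma_1=1+\left(K\lambda+\frac{2(K'-1)}{K\lambda+\sqrt{K^2\lambda^2+4K'}}\right)\ln\left(K\lambda r_1+\frac{2(K'-1)r_1}{K\lambda+\sqrt{K^2\lambda^2+4K'}}\right).$$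
   Context: $\mathbb{D}$ is the open unit disk in $\mathbb{C}$ and $\mathbb{D}_r=\{z\in\mathbb{C}:|z|<r\}$. Univalent means injective. The convention $0\cdot\ln 0=0$ is used. For a continuously differentiable $f=u+iv$ with $z=x+iy$: $f_z=\frac12(f_x-if_y)$, $f_{\bar z}=\frac12(f_x+if_y)$, $J_f=|f_z|^2-|f_{\bar z}|^2$, $\Lambda_f(z)=|f_z(z)|+|f_{\bar z}(z)|$, and $\lambda_f(z)=\bigl||f_z(z)|-|f_{\bar z}(z)|\bigr|$. $D_f=\begin{pmatrix}u_x&u_y\\ v_x&v_y\end{pmatrix}$, and for a real $2\times2$ matrix $A$, $\|A\|=\sup\{|Az|:|z|=1\}$. A sense-preserving continuous mapping $f$ from $\mathbb{D}$ into $\mathbb{C}$ is $(K,K')$-elliptic (with $K\ge1$, $K'\ge0$) if: (i) $f$ is absolutely continuous on lines in $\mathbb{D}$, i.e., for every closed rectangle $R\subset\mathbb{D}$, $f$ is absolutely continuous on almost every line segment in $R$ parallel to the coordinate axes; (ii) $f_z,f_{\bar z}\in L^2(\mathbb{D})$ and $J_f\ne0$ a.e. in $\mathbb{D}$; (iii) $\|D_f\|^2\le KJ_f+K'$ a.e. in $\mathbb{D}$. A mapping $f$ is harmonic on $\mathbb{D}$ if it is twice continuously differentiable and $4f_{z\bar z}=0$ there. A $(K,K')$-elliptic harmonic mapping is a harmonic mapping that is $(K,K')$-elliptic. *)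

(* Defs.v *)
From HB Require Import structures.
From mathcomp Require Import all_boot all_order all_algebra.
From mathcomp Require Import complex.
From mathcomp Require Import all_classical all_reals all_analysis.

Set Implicit Arguments.
Unset Strict Implicit.
Unset Printing Implicit Defensive.

Import Order.TTheory GRing.Theory Num.Theory.
Import numFieldNormedType.Exports.
Import Normc.

Local Open Scope classical_set_scope.
Local Open Scope ring_scope.
Local Open Scope complex_scope.

Local Notation Re := complex.Re.
Local Notation Im := complex.Im.

(* The modulus used throughout is the real-valued [normc]; the norm of the
   numFieldType [R[i]] itself takes its values in [R[i]].  Mappings of the unit
   disk are total functions on [R[i]] of which only the values on the disk
   matter.  The alias [R[i]^o] gives access to the usual topology of the complex
   plane and to complex derivatives. *)

Definition disk (R : realType) (r : R) : set R[i] := [set z | normc z < r].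

Definition continuous_on (R : realType) (D : set R[i]) (F : R[i] -> R[i]) : Prop :=
  forall z, D z -> {for z, continuous (F : R[i]^o -> R[i]^o)}.

Definition analytic_on (R : realType) (D : set R[i]) (F : R[i] -> R[i]) : Prop :=
  forall z, D z -> derivable (F : R[i]^o -> R[i]^o) z 1.

(* Restrictions of the real and imaginary parts of F to the horizontal and
   vertical lines through z; their derivatives are u_x, v_x, u_y and v_y. *)
Definition re_hor (R : realType) (F : R[i] -> R[i]) (z : R[i]) : R -> R :=
  fun t => Re (F (t +i* Im z)).
Definition im_hor (R : realType) (F : R[i] -> R[i]) (z : R[i]) : R -> R :=
  fun t => Im (F (t +i* Im z)).
Definition re_ver (R : realType) (F : R[i] -> R[i]) (z : R[i]) : R -> R :=
  fun t => Re (F (Re z +i* t)).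
Definition im_ver (R : realType) (F : R[i] -> R[i]) (z : R[i]) : R -> R :=
  fun t => Im (F (Re z +i* t)).

Definition pdx (R : realType) (F : R[i] -> R[i]) (z : R[i]) : R[i] :=
  derive1 (re_hor F z) (Re z) +i* derive1 (im_hor F z) (Re z).
Definition pdy (R : realType) (F : R[i] -> R[i]) (z : R[i]) : R[i] :=
  derive1 (re_ver F z) (Im z) +i* derive1 (im_ver F z) (Im z).

Definition has_partials_at (R : realType) (F : R[i] -> R[i]) (z : R[i]) : Prop :=
  [/\ derivable (re_hor F z) (Re z) 1, derivable (im_hor F z) (Re z) 1,
      derivable (re_ver F z) (Im z) 1 & derivable (im_ver F z) (Im z) 1].

Definition C1_on (R : realType) (D : set R[i]) (F : R[i] -> R[i]) : Prop :=
  [/\ forall z, D z -> has_partials_at F z,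
      continuous_on D (pdx F) & continuous_on D (pdy F)].

Definition C2_on (R : realType) (D : set R[i]) (F : R[i] -> R[i]) : Prop :=
  [/\ C1_on D F, C1_on D (pdx F) & C1_on D (pdy F)].

Definition dz (R : realType) (F : R[i] -> R[i]) (z : R[i]) : R[i] :=
  2^-1 * (pdx F z - 'i * pdy F z).
Definition dzbar (R : realType) (F : R[i] -> R[i]) (z : R[i]) : R[i] :=
  2^-1 * (pdx F z + 'i * pdy F z).

Definition jacobian (R : realType) (F : R[i] -> R[i]) (z : R[i]) : R :=
  normc (dz F z) ^+ 2 - normc (dzbar F z) ^+ 2.

Definition lambda_min (R : realType) (F : R[i] -> R[i]) (z : R[i]) : R :=
  `| normc (dz F z) - normc (dzbar F z) |.

Definition diff_mx (R : realType) (F : R[i] -> R[i]) (z : R[i]) : 'M[R]_2 :=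
  \matrix_(i < 2, j < 2)
    (let d := if j == 0 then pdx F z else pdy F z in
     if i == 0 then Re d else Im d).

(* The library norm on matrices is the maximum norm, hence this Euclidean one. *)
Definition enorm (R : realType) (v : 'cV[R]_2) : R :=
  Num.sqrt (\sum_(i < 2) v i 0 ^+ 2).

Definition opnorm (R : realType) (A : 'M[R]_2) : R :=
  sup [set enorm (A *m v) | v in [set v : 'cV[R]_2 | enorm v = 1]].

Definition harmonic_on (R : realType) (D : set R[i]) (F : R[i] -> R[i]) : Prop :=
  C2_on D F /\ forall z, D z -> 4 * dzbar (dz F) z = 0.

Definition abs_continuous (R : realType) (a b : R) (F : R -> R[i]) : Prop :=
  forall e : R, 0 < e -> exists2 d : R, 0 < d &
    forall (n : nat) (l r : 'I_n -> R),
      (forall i, [/\ a <= l i, l i <= r i & r i <= b]) ->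
      trivIset [set: 'I_n] (fun i => `]l i, r i[%classic) ->
      \sum_(i < n) (r i - l i) < d ->
      \sum_(i < n) normc (F (r i) - F (l i)) < e.

Definition abs_continuous_on_lines (R : realType) (D : set R[i])
    (F : R[i] -> R[i]) : Prop :=
  forall a b c d : R, a < b -> c < d ->
    (forall x y, a <= x <= b -> c <= y <= d -> D (x +i* y)) ->
    {ae (@lebesgue_measure R), forall y, c <= y <= d ->
       abs_continuous a b (fun x => F (x +i* y))} /\
    {ae (@lebesgue_measure R), forall x, a <= x <= b ->
       abs_continuous c d (fun y => F (x +i* y))}.

Definition plane_point (R : realType)
    (p : measurableTypeR R * measurableTypeR R) : R[i] := p.1 +i* p.2.

Definition ae_on (R : realType) (D : set R[i]) (P : R[i] -> Prop) : Prop :=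
  {ae (@lebesgue_measure R \x @lebesgue_measure R)%E,
     forall p, D (plane_point p) -> P (plane_point p)}.

Definition L2_on (R : realType) (D : set R[i]) (G : R[i] -> R[i]) : Prop :=
  let D' := (@plane_point R) @^-1` D in
  [/\ measurable_fun D' (fun p => Re (G (plane_point p))),
      measurable_fun D' (fun p => Im (G (plane_point p))) &
      (\int[(@lebesgue_measure R \x @lebesgue_measure R)%E]_(p in D')
         (normc (G (plane_point p)) ^+ 2)%:E < +oo)%E].

(* The winding number of the closed curve [c], parametrized by [0, 1], about [w]
   is [n]; only meaningful when [w] is not on the curve, and then [n] is unique. *)
Definition winding_number (R : realType) (c : R -> R[i]) (w : R[i]) (n : int) :
    Prop :=
  exists2 theta : R -> R, {within `[0, 1], continuous theta} &
    (forall t : R, 0 <= t <= 1 ->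
       c t - w = (normc (c t - w))%:C * (cos (theta t) +i* sin (theta t))) /\
    theta 1 - theta 0 = 2 * pi * n%:~R.

Definition jordan_curve_in (R : realType) (D : set R[i]) (c : R -> R[i]) : Prop :=
  [/\ {within `[0, 1], continuous (c : R -> R[i]^o)}, c 0 = c 1,
      {in `[0, 1[ &, injective c} & forall t : R, 0 <= t <= 1 -> D (c t)].

(* Topological sense-preservation on a simply connected domain: the local degree
   is positive, i.e. F(z) is encircled a positive number of times by the image of
   every positively oriented Jordan curve around z whose image avoids F(z).  A
   Jordan curve has winding number 1 about z exactly when it is positively
   oriented and z lies inside it. *)
Definition sense_preserving_on (R : realType) (D : set R[i])
    (F : R[i] -> R[i]) : Prop :=
  forall (c : R -> R[i]) (z : R[i]), jordan_curve_in D c ->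
    (forall t : R, 0 <= t <= 1 -> c t != z) -> winding_number c z 1 ->
    (forall t : R, 0 <= t <= 1 -> F (c t) != F z) ->
    exists2 n : int, 0 < n & winding_number (F \o c) (F z) n.

Definition elliptic (R : realType) (K K' : R) (F : R[i] -> R[i]) : Prop :=
  let D := disk (1 : R) in
  [/\ sense_preserving_on D F /\ continuous_on D F,
      abs_continuous_on_lines D F,
      [/\ L2_on D (dz F), L2_on D (dzbar F) &
          ae_on D (fun z => jacobian F z != 0)] &
      ae_on D (fun z => opnorm (diff_mx F z) ^+ 2 <= K * jacobian F z + K')].

(* Main.v *)
Require Import Defs.
From mathcomp Require Import all_boot all_order all_algebra.
From mathcomp Require Import complex.
From mathcomp Require Import all_classical all_reals all_analysis.
From mathcomp Require Import ring lra.
Import Order.TTheory GRing.Theory Num.Theory.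
Import numFieldNormedType.Exports.
Import Normc.
Set Implicit Arguments.
Unset Strict Implicit.
Unset Printing Implicit Defensive.
Local Open Scope classical_set_scope.
Local Open Scope ring_scope.
Local Open Scope complex_scope.
Local Notation Re := complex.Re.
Local Notation Im := complex.Im.

(* Write [L] for the differential of [f] at [0], [M = S / 2] and [a = M - 1/M],
   so that [M^2 = K lam M + K'], [r1 = 1 / (1 + a)] and [1 - r1 = a r1].
   Since [|J_f| = Lambda_f lambda_f], ellipticity gives
   [Lambda_f^2 <= K lam Lambda_f + K'], i.e. [Lambda_f <= M], almost everywhere and
   hence everywhere.  For [|c| = 1] the function [F = h' + c g'] is then bounded by
   [M] with [|F 0| >= lambda_f 0 = 1], and Schwarz-Pick gives
   [|F z - F 0| <= a |z| / (1 - |z|)]; choosing [c] suitably, this bounds the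
   derivative of [f - L].  As [|L z| >= |z|], [f] is injective where this bound is
   less than [1], and [f z = w] is solved by a contraction.
   Schwarz-Pick is derived without Cauchy's theory: the maximum principle follows
   from second-order Taylor expansions alone, and these are available for the
   difference quotients of [h + c g] because [f] is twice differentiable. *)

(** Schwarz-Pick bounds [M (1 - |z|) |F z - F 0|] by [|z| (M^2 - |F 0|^2)]; with [|F 0| >= 1] this
    produces the constant [a = (M^2 - 1) / M]. Integrating [a t / (1 - t)] along a radius gives
    [|f z - L z| <= - a (|z| + ln (1 - |z|))], hence [|f z| >= r + a (r + ln (1 - r))] when
    [|z| = r]. At [r1 = 1 / (1 + a)], the radius below which [a r / (1 - r) < 1], this lower bound
    becomes [1 + a ln (a r1)], that is [sigma1]. The obstacle is regularity. The maximum principle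
    needs second-order expansions of the function to which it is applied, whereas [f] of class C2
    makes [F] differentiable only once. One order is recovered by integration: the primitive
    [h + c g] of [F] does expand to second order, and so do its difference quotients with a fixed
    step, which converge to [F]. *)

(** * The modulus *)

Section Modulus.
Variable R : realType.
Implicit Types (x y z w : R[i]) (r e : R).

Lemma normc_ge0 z : 0 <= normc z.
Proof. by case: z => a b; exact: sqrtr_ge0. Qed.

Lemma normc_eq0 z : (normc z == 0) = (z == 0).
Proof. by apply/eqP/eqP => [/eq0_normc//|->]; exact: normc0. Qed.

Lemma normc_gt0 z : (0 < normc z) = (z != 0).
Proof. by rewrite lt_neqAle eq_sym normc_eq0 normc_ge0 andbT. Qed.

Lemma ler_normcD x y : normc (x + y) <= normc x + normc y.
Proof. exact: le_normcD. Qed.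

Lemma normc_opp z : normc (- z) = normc z.
Proof. exact: normcN. Qed.

Lemma normc_distC x y : normc (x - y) = normc (y - x).
Proof. by rewrite -normc_opp opprB. Qed.

Lemma ler_normcB x y : normc (x - y) <= normc x + normc y.
Proof. by rewrite -(normc_opp y) ler_normcD. Qed.

Lemma ler_sub_normcD x y : normc x - normc y <= normc (x + y).
Proof. by rewrite lerBlDr -{1}(addrK y x) ler_normcB. Qed.

Lemma normcX z n : normc (z ^+ n) = normc z ^+ n.
Proof. by elim: n => [|n ih]; rewrite ?expr0 ?normc1// !exprS normcM ih. Qed.

Lemma normcJ z : normc (conjc z) = normc z.
Proof. by case: z => a b; rewrite /= sqrrN. Qed.

Lemma normc_real r : normc r%:C = `|r|.
Proof. by rewrite /= expr0n addr0 sqrtr_sqr. Qed.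

Lemma normc_i : normc ('i : R[i]) = 1.
Proof. by rewrite /= expr0n add0r expr1n sqrtr1. Qed.

Lemma sqr_normc_ReIm z : normc z ^+ 2 = Re z ^+ 2 + Im z ^+ 2.
Proof. by case: z => a b; rewrite /= sqr_sqrtr// addr_ge0 ?sqr_ge0. Qed.

Lemma mulcJ z : z * conjc z = (normc z ^+ 2)%:C.
Proof.
rewrite sqr_normc_ReIm; case: z => a b /=.
by apply/eqP; rewrite eq_complex /=; apply/andP; split; apply/eqP; ring.
Qed.

Lemma ler_normc_sqr z r : 0 <= r -> (normc z <= r) = (normc z ^+ 2 <= r ^+ 2).
Proof. by move=> r0; rewrite ler_pXn2r// nnegrE ?normc_ge0. Qed.

Lemma normr_Re_le z : `|Re z| <= normc z.
Proof.
rewrite -(@ler_pXn2r _ 2) ?nnegrE ?normc_ge0// sqr_normc_ReIm.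
by rewrite real_normK ?num_real// lerDl sqr_ge0.
Qed.

Lemma Re_le_normc z : Re z <= normc z.
Proof. by apply: le_trans (normr_Re_le z); exact: ler_norm. Qed.

Lemma normr_Im_le z : `|Im z| <= normc z.
Proof.
rewrite -(@ler_pXn2r _ 2) ?nnegrE ?normc_ge0// sqr_normc_ReIm.
by rewrite real_normK ?num_real// lerDr sqr_ge0.
Qed.

Lemma normc_le_ReIm z : normc z <= `|Re z| + `|Im z|.
Proof.
have e : z = (Re z)%:C + 'i * (Im z)%:C.
  by case: z => a b; apply/eqP; rewrite eq_complex /=; apply/andP; split;
     apply/eqP; ring.
by rewrite {1}e; apply: le_trans (ler_normcD _ _) _;
   rewrite normcM normc_i mul1r !normc_real.
Qed.

Lemma normc_polar z : exists2 u, normc u = 1 & u * z = (normc z)%:C.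
Proof.
have [->|z0] := eqVneq z 0.
  by exists 1; rewrite ?normc1// mulr0 normc0.
exists (conjc z / (normc z)%:C).
  rewrite normcM normcV normcJ normc_real ger0_norm ?normc_ge0// divff//.
  by rewrite normc_eq0.
rewrite mulrAC [conjc z * z]mulrC mulcJ rmorphXn /= expr2 mulfK//.
by rewrite eq_complex /= eqxx andbT normc_eq0.
Qed.

End Modulus.

(** * Second-order Taylor expansions *)

Section Small.
Variable R : realType.
Implicit Types (E F B : R[i] -> R[i]) (e d : R).

(* [E t = o(|t|^n)] as [t -> 0]; for [n = 0], since [E 0] is included, this says
   that [E] vanishes and is continuous at [0]. *)
Definition small (n : nat) E :=
  forall e, 0 < e -> exists2 d, 0 < d &
    forall t, normc t < d -> normc (E t) <= e * normc t ^+ n.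

Definition locally_bounded B :=
  exists2 K : R, 0 < K & exists2 d, 0 < d &
    forall t, normc t < d -> normc (B t) <= K.

Lemma small_ext n E F d : 0 < d -> (forall t, normc t < d -> E t = F t) ->
  small n E -> small n F.
Proof.
move=> d0 EF sE e /sE[d' d'0 h]; exists (Num.min d d').
  by rewrite lt_min d0.
by move=> t; rewrite lt_min => /andP[td td']; rewrite -EF// h.
Qed.

Lemma eq_small n E F : E =1 F -> small n E -> small n F.
Proof. by move=> EF; apply: (@small_ext _ _ _ 1) => // t _. Qed.

Lemma smallD n E F : small n E -> small n F -> small n (fun t => E t + F t).
Proof.
move=> sE sF e e0; have e20 : 0 < e / 2 by lra.
have [d1 d10 h1] := sE _ e20; have [d2 d20 h2] := sF _ e20.
exists (Num.min d1 d2); first by rewrite lt_min d10.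
move=> t; rewrite lt_min => /andP[/h1 ht1 /h2 ht2].
by apply: le_trans (ler_normcD _ _) _; lra.
Qed.

Lemma smallM n B E : locally_bounded B -> small n E ->
  small n (fun t => B t * E t).
Proof.
move=> [K K0 [d d0 hB]] sE e e0.
have [d1 d10 h1] := sE _ (divr_gt0 e0 K0).
exists (Num.min d d1); first by rewrite lt_min d0.
move=> t; rewrite lt_min => /andP[/hB ht1 /h1 ht2]; rewrite normcM.
apply: le_trans (ler_pM (normc_ge0 _) (normc_ge0 _) ht1 ht2) _.
by rewrite mulrA [K * _]mulrC divfK// gt_eqF.
Qed.

Lemma small_leq m n E : (m <= n)%N -> small n E -> small m E.
Proof.
move=> mn sE e /[dup] e0 /sE[d d0 h]; exists (Num.min d 1).
  by rewrite lt_min d0 ltr01.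
move=> t; rewrite lt_min => /andP[/h ht t1]; apply: le_trans ht _.
rewrite ler_pM2l//; apply: ler_wiXn2l => //; [exact: normc_ge0|exact: ltW].
Qed.

Lemma small_mulX m n E : small m E -> small (m + n) (fun t => E t * t ^+ n).
Proof.
move=> sE e /sE[d d0 h]; exists d => // t /h ht.
by rewrite normcM normcX exprD mulrA ler_wpM2r// exprn_ge0// normc_ge0.
Qed.

Lemma small_id : small 0 id.
Proof.
by move=> e e0; exists e => // t /ltW; rewrite expr0 mulr1.
Qed.

Lemma small_Xn n : small n (fun t => t ^+ n.+1).
Proof. by apply: eq_small (small_mulX n small_id) => t; rewrite exprS. Qed.

Lemma locally_bounded_cst (c : R[i]) : locally_bounded (fun=> c).
Proof.
exists (normc c + 1); first by rewrite ltr_wpDl ?normc_ge0.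
by exists 1 => // t _; rewrite lerDl.
Qed.

Lemma locally_bounded_id : locally_bounded id.
Proof. by exists 1 => //; exists 1 => // t /ltW. Qed.

Lemma locally_boundedD B B' : locally_bounded B -> locally_bounded B' ->
  locally_bounded (fun t => B t + B' t).
Proof.
move=> [K K0 [d d0 h]] [K' K'0 [d' d'0 h']].
exists (K + K'); first exact: addr_gt0.
exists (Num.min d d'); first by rewrite lt_min d0.
move=> t; rewrite lt_min => /andP[/h ht1 /h' ht2].
by apply: le_trans (ler_normcD _ _) _; exact: lerD.
Qed.

Lemma locally_boundedM B B' : locally_bounded B -> locally_bounded B' ->
  locally_bounded (fun t => B t * B' t).
Proof.
move=> [K K0 [d d0 h]] [K' K'0 [d' d'0 h']].
exists (K * K'); first exact: mulr_gt0.
exists (Num.min d d'); first by rewrite lt_min d0.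
move=> t; rewrite lt_min => /andP[/h ht1 /h' ht2].
by rewrite normcM ler_pM ?normc_ge0.
Qed.

Lemma locally_bounded_quad (a b c : R[i]) :
  locally_bounded (fun t => a + b * t + c * t ^+ 2).
Proof.
apply: locally_boundedD.
  apply: locally_boundedD; first exact: locally_bounded_cst.
  exact: locally_boundedM (locally_bounded_cst b) locally_bounded_id.
apply: locally_boundedM; first exact: locally_bounded_cst.
exact: locally_boundedM locally_bounded_id locally_bounded_id.
Qed.

Lemma small_locally_bounded n E : small n E -> locally_bounded E.
Proof.
move=> /(small_leq (leq0n n)) /(_ _ ltr01)[d d0 h].
by exists 1 => //; exists d => // t /h; rewrite expr0 mulr1.
Qed.

Lemma smallMl n (c : R[i]) E : small n E -> small n (fun t => c * E t).
Proof. exact: smallM (locally_bounded_cst c). Qed.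

Lemma smallB n E F : small n E -> small n F -> small n (fun t => E t - F t).
Proof.
move=> sE sF; apply: eq_small (smallD sE (smallMl (-1) sF)) => t.
by rewrite mulN1r.
Qed.

(** Stated through [small], continuity shares the calculus of error terms with the Taylor
    expansions. *)
Definition ccont (Q : R[i] -> R[i]) z := small 0 (fun t => Q (z + t) - Q z).

(** Only powers of [t] occur, no [conjc t]: this is a complex Taylor expansion at the single point
    [z]. It survives sums, products, inverses and translations, which covers all functions built
    below. *)
Definition expand2 (Q : R[i] -> R[i]) z := exists b c,
  small 2 (fun t => Q (z + t) - (Q z + b * t + c * t ^+ 2)).

Lemma expand2_ccont Q z : expand2 Q z -> ccont Q z.
Proof.
move=> [b [c /(small_leq (leq0n 2))h]].
have h1 := smallM (locally_boundedD (locally_bounded_cst b)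
  (locally_boundedM (locally_bounded_cst c) locally_bounded_id)) small_id.
by apply: eq_small (smallD h h1) => t /=; ring.
Qed.

Lemma ccont_bounded Q z : ccont Q z -> locally_bounded (fun t => Q (z + t)).
Proof.
move=> /small_locally_bounded h.
have [K K0 [d d0 hh]] := locally_boundedD (locally_bounded_cst (Q z)) h.
by exists K => //; exists d => // t /hh; rewrite [_ + _](addrC (Q z)) subrK.
Qed.

Lemma expand2_cst (c : R[i]) z : expand2 (fun=> c) z.
Proof.
exists 0, 0 => e e0; exists 1 => // t _.
rewrite !mul0r !addr0 subrr normc0.
by rewrite mulr_ge0 ?(ltW e0)// exprn_ge0// normc_ge0.
Qed.

Lemma expand2_id z : expand2 id z.
Proof.
exists 1, 0 => e e0; exists 1 => // t _.
rewrite mul1r mul0r addr0 subrr normc0.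
by rewrite mulr_ge0 ?(ltW e0)// exprn_ge0// normc_ge0.
Qed.

Lemma expand2D P Q z : expand2 P z -> expand2 Q z ->
  expand2 (fun x => P x + Q x) z.
Proof.
move=> [b [c h]] [b' [c' h']]; exists (b + b'), (c + c').
by apply: eq_small (smallD h h') => t; ring.
Qed.

Lemma expand2M P Q z : expand2 P z -> expand2 Q z ->
  expand2 (fun x => P x * Q x) z.
Proof.
move=> hP hQ; have bQ := ccont_bounded (expand2_ccont hQ).
move: hP hQ => [b [c h]] [b' [c' h']].
exists (b * Q z + P z * b'), (P z * c' + b * b' + c * Q z).
have bP : locally_bounded (fun t => P z + b * t + c * t ^+ 2).
  exact: locally_bounded_quad.
have s3 := smallMl (b * c' + c * b') (small_Xn 2).
have s4 := smallMl (c * c') (small_leq (isT : 2 <= 3)%N (small_Xn 3)).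
apply: eq_small (smallD (smallD (smallM bQ h) (smallM bP h')) (smallD s3 s4)).
by move=> t; ring.
Qed.

Lemma expand2X Q z n : expand2 Q z -> expand2 (fun x => Q x ^+ n) z.
Proof.
move=> h; elim: n => [|n ih]; first exact: expand2_cst.
have [b [c hh]] := expand2M h ih; exists b, c.
by apply: eq_small hh => t; rewrite -!exprS.
Qed.

Lemma ccont_neq0 Q z : ccont Q z -> Q z != 0 ->
  exists2 d : R, 0 < d & forall t, normc t < d -> normc (Q z) / 2 <= normc (Q (z + t)).
Proof.
move=> cQ; rewrite -normc_gt0 => Q0.
have [|d d0 h] := cQ (normc (Q z) / 2); first lra.
exists d => // t /h; rewrite expr0 mulr1 => ht.
have := ler_sub_normcD (Q z) (Q (z + t) - Q z).
by rewrite [Q z + _]addrC subrK; lra.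
Qed.

Lemma expand2V Q z : expand2 Q z -> Q z != 0 -> expand2 (fun x => (Q x)^-1) z.
Proof.
move=> hQ Qz0; have [d d0 hd] := ccont_neq0 (expand2_ccont hQ) Qz0.
have Qpos : 0 < normc (Q z) by rewrite normc_gt0.
have nz t : normc t < d -> Q (z + t) != 0.
  by move=> /hd ht; rewrite -normc_gt0; lra.
have bV : locally_bounded (fun t => (Q (z + t))^-1).
  exists (normc (Q z) / 2)^-1; first by rewrite invr_gt0; lra.
  exists d => // t td; rewrite normcV lef_pV2 ?posrE ?normc_gt0 ?nz//; last lra.
  exact: hd.
move: hQ => [b [c h]].
set q := Q z in h Qz0 *.
(* With these coefficients [(q + b t + c t^2) (q^-1 + b' t + c' t^2)] is [1] up to terms in [t^3]
   and [t^4], which [s3] and [s4] absorb. *)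
set b' := - b / q ^+ 2; set c' := b ^+ 2 / q ^+ 3 - c / q ^+ 2.
exists b', c'.
have bP : locally_bounded (fun t => q^-1 + b' * t + c' * t ^+ 2).
  exact: locally_bounded_quad.
have s3 := smallMl (b * c' + c * b') (small_Xn 2).
have s4 := smallMl (c * c') (small_leq (isT : 2 <= 3)%N (small_Xn 3)).
have := smallMl (-1) (smallM bV (smallD (smallM bP h) (smallD s3 s4))).
apply: (small_ext d0) => t /nz nzt.
rewrite /b' /c' -/q; field.
by rewrite Qz0 nzt.
Qed.

Lemma expand2_shift Q z w : expand2 Q (z + w) -> expand2 (fun x => Q (x + w)) z.
Proof.
move=> [b [c h]]; exists b, c.
by apply: eq_small h => t; rewrite addrAC.
Qed.

End Small.

(** * Maximum principle *)

Section MaximumPrinciple.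
Variable R : realType.

(** The disk is transported to row vectors of length 2, where closed bounded sets are compact;
    squaring [normc <= r] turns it into a polynomial condition, hence a closed one. *)
Lemma EVT_disk (u : R[i] -> R) (r : R) : 0 <= r ->
  (forall z, normc z <= r -> ccont (fun x => (u x)%:C) z) ->
  exists2 z0, normc z0 <= r & forall z, normc z <= r -> u z <= u z0.
Proof.
move=> r0 cu; pose c (v : 'rV[R]_2) := v ord0 ord0 +i* v ord0 ord_max.
pose A : set 'rV[R]_2 := [set v | normc (c v) <= r].
pose N (v : 'rV[R]_2) := v ord0 ord0 * v ord0 ord0 + v ord0 ord_max * v ord0 ord_max.
have AE : A = N @^-1` [set x | x <= r ^+ 2].
  apply/seteqP; split => v; rewrite /A /N /= -!expr2 -(@ler_pXn2r _ 2 _ (Num.sqrt _))//;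
  by rewrite ?nnegrE ?sqrtr_ge0// sqr_sqrtr// addr_ge0 ?sqr_ge0.
have cN : continuous N.
  move=> v; have h i := @coord_continuous R 1 2 ord0 i v.
  exact: cvgD (cvgM (h _) (h _)) (cvgM (h _) (h _)).
have clA : closed A.
  rewrite AE; apply: closed_comp; first by move=> v _; exact: cN.
  exact: closed_le.
have bdA : bounded_set A.
  exists r; split; first exact: num_real.
  move=> x rx v Av; rewrite /= [leLHS]mx_normrE.
  apply: bigmax_le => [|[i j] _]; first exact: le_trans r0 (ltW rx).
  apply: le_trans _ (ltW rx); apply: le_trans _ Av => /=.
  rewrite (ord1 i); case: j => -[|[|//]] hj.
  - by apply: le_trans (normr_Re_le (c v)); rewrite (_ : Ordinal hj = ord0)//;
      exact: val_inj.
  - by apply: le_trans (normr_Im_le (c v)); rewrite (_ : Ordinal hj = ord_max)//;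
      exact: val_inj.
have [||v0 Av0 mx] := @EVT_max_rV R 2 (fun v => u (c v)) A _
    (bounded_closed_compact bdA clA).
- by exists 0; rewrite /A /= !mxE expr0n addr0 sqrtr0.
- apply: continuous_in_subspaceT => v; rewrite inE => Av.
  apply/(@cvgrPdist_lt _ _ _ _ (nbhs_filter v)) => e e0.
  have [d d0 hd'] : exists2 d, 0 < d & forall t, normc t < d ->
      `|u (c v + t) - u (c v)| < e.
    have [|d d0 hd] := cu _ Av (e / 2); first lra.
    exists d => // t /hd; rewrite expr0 mulr1 -rmorphB normc_real => h.
    by apply: le_lt_trans h _; lra.
  have d20 : 0 < d / 2 by lra.
  have /(@cvgrPdist_lt _ _ _ _ (nbhs_filter v))/(_ _ d20) n1 := @coord_continuous _ _ _ ord0 ord0 v.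
  have /(@cvgrPdist_lt _ _ _ _ (nbhs_filter v))/(_ _ d20) n2 := @coord_continuous _ _ _ ord0 ord_max v.
  apply: (@filterS2 _ (nbhs v) (nbhs_filter v) _ _ _ _ n1 n2) => w h1 h2.
  rewrite distrC (_ : c w = c v + (c w - c v)); last by rewrite addrC subrK.
  apply: hd'; apply: le_lt_trans (normc_le_ReIm _) _ => /=.
  move: h1 h2 => /= h1 h2.
  by rewrite distrC [X in _ + X]distrC; lra.
exists (c v0); first by rewrite inE in Av0.
move=> [a b] hz; pose w : 'rV[R]_2 := \row_j (if j == 0 then a else b).
have cw : c w = a +i* b by rewrite /c !mxE.
by rewrite -cw; apply: mx; rewrite inE; change (normc (c w) <= r); rewrite cw.
Qed.

Lemma ccont_cst (c z : R[i]) : ccont (fun=> c) z.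
Proof. exact: expand2_ccont (expand2_cst c z). Qed.

Lemma ccont_id (z : R[i]) : ccont id z.
Proof. exact: expand2_ccont (expand2_id z). Qed.

Lemma ccontD P Q (z : R[i]) : ccont P z -> ccont Q z ->
  ccont (fun x => P x + Q x) z.
Proof. by move=> h k; apply: eq_small (smallD h k) => t; ring. Qed.

Lemma ccontM P Q (z : R[i]) : ccont P z -> ccont Q z ->
  ccont (fun x => P x * Q x) z.
Proof.
move=> h k; have bQ := ccont_bounded k.
by apply: eq_small (smallD (smallM bQ h) (smallMl (P z) k)) => t; ring.
Qed.

Lemma ccontJ P (z : R[i]) : ccont P z -> ccont (fun x => conjc (P x)) z.
Proof.
move=> h e /h[d d0 hd]; exists d => // t /hd.
by rewrite -rmorphB /= normcJ.
Qed.

(* Average over the four directions [t, it, -t, -it]: the linear and quadratic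
   terms of [Q] contribute nothing to the mean of [|Q|^2] beyond the nonnegative
   squares of their coefficients. *)
Lemma expand2_not_max Q (z : R[i]) (eps d : R) : 0 < eps -> 0 < d ->
  expand2 Q z -> exists2 t : R[i], normc t < d &
    normc (Q z) ^+ 2 + eps * normc z ^+ 2 <
    normc (Q (z + t)) ^+ 2 + eps * normc (z + t) ^+ 2.
Proof.
move=> eps0 d0 [b [c hE]].
have [K K0 [d1 d10 hK]] := locally_bounded_quad (Q z) b c.
(* With this tolerance the cross term [2 |p| |E|] costs at most [eps s^2 / 2], half of what
   [eps |z + t|^2] gains on average over the four directions. *)
have [|d2 d20 hE2] := hE (eps / (4 * K)); first by rewrite divr_gt0 ?mulr_gt0.
pose s := Num.min d (Num.min d1 d2) / 2.
have s0 : 0 < s by rewrite divr_gt0// !lt_min d0 d10.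
have [sd sd1 sd2] : [/\ s < d, s < d1 & s < d2].
  have : s < Num.min d (Num.min d1 d2).
    by rewrite /s ltr_pdivrMr// ltr_pMr ?ltr1n// !lt_min d0 d10.
  by rewrite !lt_min => /and3P[].
apply: contrapT => hN.
have le t : normc t = s ->
    normc (Q z + b * t + c * t ^+ 2) ^+ 2 + eps * normc (z + t) ^+ 2 <=
    normc (Q z) ^+ 2 + eps * normc z ^+ 2 + eps / 2 * s ^+ 2.
  move=> ts.
  have h1 : normc (Q (z + t)) ^+ 2 + eps * normc (z + t) ^+ 2 <=
      normc (Q z) ^+ 2 + eps * normc z ^+ 2.
    by rewrite leNgt; apply/negP => h; apply: hN; exists t; rewrite ?ts.
  have := hE2 t; rewrite ts => /(_ sd2).
  have := hK t; rewrite ts => /(_ sd1).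
  set p := _ + c * _; set E := _ - p => pK EK.
  have QE : Q (z + t) = p + E by rewrite /E [p + _]addrC subrK.
  have := ler_sub_normcD p E; rewrite -QE => h2.
  have h3 : normc p ^+ 2 - 2 * normc p * normc E <= normc (Q (z + t)) ^+ 2.
    have [h4|h4] := leP (normc E) (normc p); last first.
      by apply: le_trans (sqr_ge0 _); have := normc_ge0 p; nra.
    apply: le_trans (_ : (normc p - normc E) ^+ 2 <= _).
      by have := sqr_ge0 (normc E); nra.
    by rewrite ler_pXn2r// nnegrE ?normc_ge0//; lra.
  have h5 : 2 * normc p * normc E <= eps / 2 * s ^+ 2.
    rewrite (_ : eps / 2 * s ^+ 2 = 2 * K * (eps / (4 * K) * s ^+ 2)).
      by apply: ler_pM; rewrite ?mulr_ge0 ?normc_ge0//; lra.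
    by field; rewrite gt_eqF.
  lra.
have ns : normc (s%:C) = s by rewrite normc_real gtr0_norm.
have n1 := le _ ns.
have n2 : normc ('i * s%:C) = s by rewrite normcM normc_i mul1r.
have {}n2 := le _ n2.
have n3 : normc (- s%:C) = s by rewrite normc_opp.
have {}n3 := le _ n3.
have n4 : normc (- ('i * s%:C)) = s by rewrite normc_opp normcM normc_i mul1r.
have {}n4 := le _ n4.
move: (addr_gt0 s0 s0) n1 n2 n3 n4; rewrite !sqr_normc_ReIm.
case: (Q z) => qx qy; case: b {hE hK hE2 le} => bx by_; case: c => cx cy.
case: z {hN} => zx zy; rewrite !(expr2 (_ : R[i])) /= => _ n1 n2 n3 n4.
have : 0 < eps * s ^+ 2 by rewrite mulr_gt0// exprn_gt0.
have : 0 <= (bx ^+ 2 + by_ ^+ 2) * s ^+ 2 by rewrite mulr_ge0 ?addr_ge0 ?sqr_ge0.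
have : 0 <= (cx ^+ 2 + cy ^+ 2) * s ^+ 4.
  by rewrite mulr_ge0 ?exprn_even_ge0 ?addr_ge0 ?sqr_ge0.
nra.
Qed.

(** A penalty [eps |z|^2] makes the maximum principle strict. At a zero of [Q] the penalized
    function is at most [eps r^2], too small for a maximum, so no expansion is required there; this
    admits quotients whose singular point is a zero. *)
Lemma max_modulus Q (r B : R) : 0 <= r -> 0 <= B ->
  (forall z, normc z <= r -> ccont Q z) ->
  (forall z, normc z < r -> Q z != 0 -> expand2 Q z) ->
  (forall z, normc z = r -> normc (Q z) <= B) ->
  forall z, normc z <= r -> normc (Q z) <= B.
Proof.
move=> r0 B0 cQ eQ bQ z1 z1r; rewrite leNgt; apply/negP => hB.
have r21 : 0 < r ^+ 2 + 1 by rewrite ltr_wpDl ?sqr_ge0.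
(* Chosen so that [|Q z1|^2] exceeds the boundary bound [B^2 + eps r^2] of the penalized function by
   exactly [eps]. *)
pose eps := (normc (Q z1) ^+ 2 - B ^+ 2) / (r ^+ 2 + 1).
have eps0 : 0 < eps.
  by rewrite divr_gt0// subr_gt0 ltr_pXn2r// nnegrE// ltW// (le_lt_trans B0).
have epsE : normc (Q z1) ^+ 2 = B ^+ 2 + eps * r ^+ 2 + eps.
  by rewrite /eps; field; rewrite gt_eqF.
pose u z := normc (Q z) ^+ 2 + eps * normc z ^+ 2.
have [|z0 z0r mx] := @EVT_disk u r r0.
  move=> z zr; have c1 := cQ _ zr.
  have := ccontD (ccontM c1 (ccontJ c1))
    (ccontM (ccont_cst eps%:C z) (ccontM (ccont_id z) (ccontJ (ccont_id z)))).
  by apply: eq_small => t; rewrite /u !mulcJ !rmorphD !rmorphM.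
have gtB : B ^+ 2 + eps * r ^+ 2 < u z0.
  apply: lt_le_trans (mx _ z1r); rewrite /u epsE.
  by have := mulr_ge0 (ltW eps0) (sqr_ge0 (normc z1)); lra.
have z0lt : normc z0 < r.
  rewrite lt_neqAle z0r andbT; apply/eqP => z0E.
  have := bQ _ z0E => h; move: gtB; rewrite /u z0E ltrD2r ltNge.
  by rewrite ler_pXn2r ?nnegrE ?normc_ge0// h.
have Qz0 : Q z0 != 0.
  apply/eqP => Q0; move: gtB; rewrite /u Q0 normc0 ltNge => /negP; apply.
  rewrite expr0n add0r; apply: le_trans (_ : eps * r ^+ 2 <= _); last first.
    by rewrite lerDr sqr_ge0.
  by rewrite ler_pM2l// ler_pXn2r// nnegrE ?normc_ge0.
have d0 : 0 < r - normc z0 by rewrite subr_gt0.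
have [t td] := expand2_not_max eps0 d0 (eQ _ z0lt Qz0).
rewrite ltNge => /negP; apply; apply: mx.
by apply: le_trans (ler_normcD _ _) _; move: td; rewrite ltrBrDl => /ltW.
Qed.

End MaximumPrinciple.

(** * Schwarz-Pick lemma *)

Section SchwarzPick.
Variable R : realType.

Lemma bernoulli_ineq (q : R) n : 0 <= q -> n%:R * q <= (1 + q) ^+ n.
Proof.
move=> q0; suff : 1 + n%:R * q <= (1 + q) ^+ n by lra.
elim: n => [|n ih]; first by rewrite mul0r addr0.
rewrite exprS -natr1; apply: le_trans (ler_wpM2l _ ih); last lra.
by have := mulr_ge0 (ler0n R n) (mulr_ge0 q0 q0); nra.
Qed.

(* The (n+2)-nd power of [w] divided by the (n+1)-st power of the variable is
   continuous at [0] without any knowledge of the removability of the singularity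
   of [w x / x]; the exponents disappear as [n] tends to infinity. *)
Lemma schwarz_power (w : R[i] -> R[i]) (r0 r : R) n : 0 < r -> r < r0 ->
  (forall z, normc z < r0 -> expand2 w z) ->
  (forall z, normc z < r0 -> normc (w z) <= 1) -> w 0 = 0 ->
  forall z, normc z <= r -> normc (w z) ^+ n.+2 * r ^+ n.+1 <= normc z ^+ n.+1.
Proof.
move=> rpos rr0 ew w1 w0 z zr.
have lt0 x : normc x <= r -> normc x < r0 by move=> h; exact: le_lt_trans rr0.
have [->|z0] := eqVneq z 0; first by rewrite w0 normc0 expr0n mul0r expr0n.
have rn0 : 0 < r ^+ n.+1 by rewrite exprn_gt0.
have zn0 : 0 < normc z ^+ n.+1 by rewrite exprn_gt0// normc_gt0.
rewrite -ler_pdivlMr// -ler_pdivrMl//.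
pose Q x := w x ^+ n.+2 / x ^+ n.+1.
have eQ x : normc x < r0 -> x != 0 -> expand2 Q x.
  move=> xr x0; apply: expand2M (expand2X _ (ew _ xr)) _.
  by apply: expand2V; [exact: expand2X (expand2_id _)|rewrite expf_neq0].
have Q0 : Q 0 = 0 by rewrite /Q w0 expr0n mul0r.
have := @max_modulus R Q r (r ^+ n.+1)^-1 (ltW rpos).
have -> : (normc z ^+ n.+1)^-1 * normc (w z) ^+ n.+2 = normc (Q z).
  by rewrite normcM normcV !normcX mulrC.
apply => //.
- by rewrite invr_ge0 ltW.
- move=> x xr; have [x0|x0] := eqVneq x 0; last first.
    by apply: expand2_ccont; apply: eQ => //; exact: lt0.
  subst x; have [b [c /(_ _ ltr01)[d d0 hd]]] := ew _ (lt0 _ xr).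
  (* The linear bound [|w t| <= K |t|] near [0] and the one spare factor of [w] give
     [|Q t| <= K^(n+2) |t|]. *)
  pose K := normc b + normc c + 1.
  have K0 : 0 < K by rewrite ltr_wpDl ?addr_ge0 ?normc_ge0.
  have wK t : normc t < d -> normc t < 1 -> normc (w t) <= K * normc t.
    move=> td t1; have := hd _ td; rewrite w0 !add0r mul1r => h.
    rewrite -[w t](subrK (b * t + c * t ^+ 2)).
    apply: le_trans (ler_normcD _ _) _.
    apply: le_trans (lerD h (ler_normcD _ _)) _; rewrite ?normcX ?normcM ?normcX.
    have t0 := normc_ge0 t; have c0 := normc_ge0 c.
    have : normc t ^+ 2 <= normc t by nra.
    have : normc c * normc t ^+ 2 <= normc c * normc t.
      by rewrite ler_wpM2l//; nra.
    by rewrite /K; lra.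
  move=> e e0; exists (Num.min (Num.min d 1) (e / K ^+ n.+2)).
    by rewrite !lt_min d0 ltr01 divr_gt0// exprn_gt0.
  move=> t; rewrite !lt_min => /andP[/andP[td t1] te].
  rewrite Q0 subr0 add0r expr0 mulr1.
  have [->|t0] := eqVneq t 0; first by rewrite Q0 normc0 ltW.
  have tp : 0 < normc t by rewrite normc_gt0.
  rewrite normcM normcV !normcX ler_pdivrMr ?exprn_gt0//.
  apply: le_trans (_ : (K * normc t) ^+ n.+2 <= _).
    by rewrite ler_pXn2r ?nnegrE ?mulr_ge0 ?normc_ge0 ?(ltW K0) ?wK.
  rewrite exprMn [normc t ^+ n.+2]exprS mulrA ler_pM2r ?exprn_gt0//.
  by rewrite mulrC -ler_pdivlMr ?exprn_gt0// ltW.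
- move=> x xr Qx0; apply: eQ; first exact: lt_trans rr0.
  by apply: contraNneq Qx0 => ->; rewrite Q0.
- move=> x xr; rewrite normcM normcV !normcX xr ler_piMl ?invr_ge0 ?(ltW rn0)//.
  by rewrite exprn_ile1 ?normc_ge0// w1// xr.
Qed.

(** If [|w z| r / |z| = 1 + q > 1], then [schwarz_power] says [|w z| (1 + q)^(n+1) <= 1], which
    Bernoulli's inequality refutes once [n] exceeds [1 / (|w z| q)]. *)
Lemma schwarz_lemma (w : R[i] -> R[i]) (r0 : R) :
  (forall z, normc z < r0 -> expand2 w z) ->
  (forall z, normc z < r0 -> normc (w z) <= 1) -> w 0 = 0 ->
  forall z, normc z < r0 -> normc (w z) * r0 <= normc z.
Proof.
move=> ew w1 w0 z zr0.
have [->|z0] := eqVneq z 0; first by rewrite w0 normc0 mul0r.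
have zp : 0 < normc z by rewrite normc_gt0.
have main r : normc z <= r -> r < r0 -> normc (w z) * r <= normc z.
  move=> zr rr0; have rp := lt_le_trans zp zr.
  rewrite leNgt; apply/negP => lt.
  have wp : 0 < normc (w z).
    rewrite lt_neqAle normc_ge0 andbT; apply: contraTN lt => /eqP <-.
    by rewrite mul0r -leNgt ltW.
  pose q := normc (w z) * r / normc z - 1.
  have q0 : 0 < q by rewrite subr_gt0 ltr_pdivlMr// mul1r.
  pose n := Num.bound (normc (w z) * q)^-1.
  have := @schwarz_power w r0 r n rp rr0 ew w1 w0 z zr.
  rewrite leNgt => /negP; apply; rewrite [normc (w z) ^+ _]exprS -mulrA -exprMn.
  rewrite -ltr_pdivrMr ?exprn_gt0 ?mulr_gt0// -exprVn -exprMn.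
  have -> : normc z / (normc (w z) * r) = (1 + q)^-1.
    by rewrite /q addrC subrK invf_div.
  rewrite exprVn invf_plt ?posrE ?exprn_gt0//; last lra.
  apply: lt_le_trans (bernoulli_ineq _ (ltW q0)).
  rewrite -ltr_pdivrMr// -invfM; apply: lt_trans (archi_boundP _) _.
    by rewrite invr_ge0 mulr_ge0// ltW.
  by rewrite ltr_nat.
apply/ler_addgt0Pr => e e0.
have wz1 := w1 _ zr0; have wz0 := normc_ge0 (w z).
(* As [|w z| <= 1], replacing this [r] by [r0] costs at most [e]. *)
pose r := Num.max (normc z) (r0 - e).
have [h1 h2] : normc z <= r /\ r < r0.
  by rewrite le_max lexx gt_max zr0 gtrDl oppr_lt0.
have h3 : r0 - e <= r by rewrite le_max lexx orbT.
by have := main _ h1 h2; nra.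
Qed.

(** The Schwarz lemma is applied to the Moebius transform [N (G - G 0) / (N^2 - conjc (G 0) G)].
    Taking [N > M] keeps the denominator away from [0] even if [|G 0| = M]; then [N] decreases to
    [M]. *)
Lemma schwarz_pick (G : R[i] -> R[i]) (M r0 : R) : 0 < M ->
  (forall z, normc z < r0 -> expand2 G z) ->
  (forall z, normc z < r0 -> normc (G z) <= M) ->
  forall z, normc z < r0 ->
    M * (r0 - normc z) * normc (G z - G 0) <= normc z * (M ^+ 2 - normc (G 0) ^+ 2).
Proof.
move=> M0 eG bG z zr0.
have r0p : 0 < r0 := le_lt_trans (normc_ge0 z) zr0.
have G0M : normc (G 0) <= M by apply: bG; rewrite normc0.
have main N : M < N -> N * (r0 - normc z) * normc (G z - G 0) <=
    normc z * (N ^+ 2 - normc (G 0) ^+ 2).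
  move=> MN; have N0 : 0 < N by lra.
  pose D x := (N ^+ 2)%:C - conjc (G 0) * G x.
  have DE x : normc (D x) ^+ 2 = N ^+ 2 * normc (G x - G 0) ^+ 2 +
      (N ^+ 2 - normc (G 0) ^+ 2) * (N ^+ 2 - normc (G x) ^+ 2).
    rewrite !sqr_normc_ReIm /D; case: (G 0) => a b; case: (G x) => c d /=.
    ring.
  have sq x : normc x <= M -> 0 < N ^+ 2 - normc x ^+ 2.
    move=> xM; rewrite subr_gt0 ltr_pXn2r ?nnegrE ?normc_ge0//; lra.
  have D0 x : normc x < r0 -> D x != 0.
    move=> xr; rewrite -normc_gt0 lt_neqAle normc_ge0 andbT eq_sym.
    apply/eqP => h; have := DE x; rewrite h expr0n /=.
    have := mulr_gt0 (sq _ G0M) (sq _ (bG _ xr)).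
    by have := mulr_ge0 (sqr_ge0 N) (sqr_ge0 (normc (G x - G 0))); lra.
  pose w x := N%:C * (G x - G 0) / D x.
  have ew x : normc x < r0 -> expand2 w x.
    move=> xr; apply: expand2M; last first.
      apply: expand2V; last exact: D0.
      have := expand2D (expand2_cst (N ^+ 2)%:C x)
        (expand2M (expand2_cst (- conjc (G 0)) x) (eG _ xr)).
      move=> [b [c h]]; exists b, c; apply: eq_small h => t.
      by rewrite /D !mulNr.
    apply: expand2M (expand2_cst _ _) _.
    exact: expand2D (eG _ xr) (expand2_cst _ _).
  have w1 x : normc x < r0 -> normc (w x) <= 1.
    move=> xr; rewrite normcM normcV ler_pdivrMr ?normc_gt0 ?D0// mul1r.
    rewrite -(@ler_pXn2r _ 2) ?nnegrE ?normc_ge0// DE.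
    rewrite normcM normc_real (gtr0_norm N0) exprMn lerDl.
    by apply: mulr_ge0; apply: ltW; apply: sq => //; exact: bG.
  have w0 : w 0 = 0 by rewrite /w subrr mulr0 mul0r.
  have := schwarz_lemma ew w1 w0 zr0.
  rewrite normcM normcV normcM normc_real (gtr0_norm N0).
  have Dz : 0 < normc (D z) by rewrite normc_gt0 D0.
  rewrite -mulrA [_^-1 * _]mulrC mulrA ler_pdivrMr//.
  move=> h.
  (* Splitting [D z] into [D 0] and a multiple of [G z - G 0] leaves a term [|z| N |G z - G 0|] to
     be moved to the left: hence the factor [r0 - |z|]. *)
  have h2 : normc (D z) <= (N ^+ 2 - normc (G 0) ^+ 2) +
      N * normc (G z - G 0).
    have -> : D z = (N ^+ 2 - normc (G 0) ^+ 2)%:C - conjc (G 0) * (G z - G 0).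
      by rewrite rmorphB /= -mulcJ /D; ring.
    apply: le_trans (ler_normcB _ _) _.
    rewrite normcM normcJ normc_real (gtr0_norm (sq _ G0M)) lerD2l.
    by rewrite ler_wpM2r ?normc_ge0//; lra.
  have := ler_wpM2l (normc_ge0 z) h2; lra.
apply/ler_addgt0Pr => e e0.
have zp := normc_ge0 z; have K0 : 0 < normc z * (2 * M + 1) + 1 by nra.
(* Here [s] is [N - M]. For [s <= 1], [N^2 - M^2 <= (2 M + 1) s]; the added [1] keeps the
   denominator positive at [z = 0]. *)
pose s := Num.min 1 (e / (normc z * (2 * M + 1) + 1)).
have s0 : 0 < s by rewrite lt_min ltr01 divr_gt0.
have s1 : s <= 1 by rewrite ge_min lexx.
have se : normc z * (2 * M + 1) * s <= e.
  apply: le_trans (_ : s * (normc z * (2 * M + 1) + 1) <= _); first lra.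
  by rewrite -ler_pdivlMr// ge_min lexx orbT.
have h := main (M + s) ltac:(lra).
have X0 := normc_ge0 (G z - G 0).
have h1 : 0 <= s * (r0 - normc z) * normc (G z - G 0).
  by rewrite !mulr_ge0// ?subr_ge0 ltW.
have h2 : normc z * s ^+ 2 <= normc z * s by rewrite ler_wpM2l//; nra.
nra.
Qed.

End SchwarzPick.

(** * Real differentials and the mean value inequality *)

Section Differentials.
Variable R : realType.

Lemma complex_gt0 (e : R) : (0 < e%:C :> R[i]) = (0 < e).
Proof. by rewrite ltcR. Qed.

(** Radii and tolerances of the topology on [R[i]] are elements of [R[i]]; being positive in its
    partial order makes them real. *)
Lemma pos_complexE (x : R[i]) : 0 < x -> x = (Re x)%:C /\ 0 < Re x.
Proof.
by case: x => a b; rewrite ltcE /= => /andP[/eqP -> a0].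
Qed.

Lemma normcC (z : R[i]) : `|z| = (normc z)%:C.
Proof. by []. Qed.

Lemma ccont_of_continuous (F : R[i] -> R[i]) (z : R[i]) :
  {for z, continuous (F : R[i]^o -> R[i]^o)} -> ccont F z.
Proof.
move=> /cvgrPdist_lt H e e0.
have := H e%:C; rewrite complex_gt0 => /(_ e0) /nbhs_normP[d /= /pos_complexE[-> d0]].
move=> h; exists (Re d) => // t td; rewrite expr0 mulr1.
have := h (z + t); rewrite /ball_ /= -/(normc _) normcC.
rewrite opprD addrA subrr sub0r normc_opp ltcR => /(_ td).
by rewrite normcC ltcR normc_distC => /ltW.
Qed.

(* The real differential of [A] at [z] is [t |-> a t + b conjc t]. *)
Definition rdiff (A : R[i] -> R[i]) (z a b : R[i]) :=
  small 1 (fun t => A (z + t) - (A z + a * t + b * conjc t)).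

Lemma rdiff_of_derivable (F : R[i] -> R[i]) (z : R[i]) :
  derivable (F : R[i]^o -> R[i]^o) z 1 -> exists a, rdiff F z a 0.
Proof.
move=> /cvgrPdist_lt H.
set l := lim _ in H; exists l => e e0.
have := H e%:C; rewrite complex_gt0 => /(_ e0).
rewrite near_withinE => /nbhs_normP[d /= /pos_complexE[-> d0]] h.
exists (Re d) => // t td; rewrite expr1.
have [->|t0] := eqVneq t 0.
  by rewrite mulr0 mul0r !addr0 subrr normc0 mulr0.
have tp : 0 < normc t by rewrite normc_gt0.
have := h t; rewrite /ball_ /= -/(normc _) normcC sub0r normc_opp ltcR.
move=> /(_ td t0); rewrite normcC ltcR /GRing.scale /= mulr1 [t + z]addrC => /ltW lt.
rewrite -ler_pdivrMr// -normcV -normcM; apply: le_trans lt.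
rewrite normc_distC mul0r addr0 le_eqVlt; apply/orP; left; apply/eqP.
by congr normc; field.
Qed.

Lemma eq_rdiff A B z a b : A =1 B -> rdiff A z a b -> rdiff B z a b.
Proof. by move=> AB; apply: eq_small => t; rewrite !AB. Qed.

Lemma rdiff_ext A B z a b (d : R) : 0 < d ->
  (forall t, normc t < d -> A (z + t) = B (z + t)) ->
  rdiff A z a b -> rdiff B z a b.
Proof.
move=> d0 AB; apply: (small_ext d0) => t td; rewrite AB//.
by have := AB 0; rewrite normc0 addr0 => ->.
Qed.

Lemma rdiffD A B z a b a' b' : rdiff A z a b -> rdiff B z a' b' ->
  rdiff (fun x => A x + B x) z (a + a') (b + b').
Proof. by move=> h k; apply: eq_small (smallD h k) => t; ring. Qed.

Lemma rdiffZ (c : R[i]) A z a b : rdiff A z a b ->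
  rdiff (fun x => c * A x) z (c * a) (c * b).
Proof. by move=> h; apply: eq_small (smallMl c h) => t; ring. Qed.

Lemma rdiffJ A z a b : rdiff A z a b -> rdiff (fun x => conjc (A x)) z (conjc b) (conjc a).
Proof.
move=> h e /h[d d0 hd]; exists d => // t /hd.
rewrite -normcJ; congr (normc _ <= _).
by rewrite !(rmorphB, rmorphD, rmorphM) /= conjcK; ring.
Qed.

Lemma rdiff_id z : rdiff id z 1 0.
Proof.
move=> e e0; exists 1 => // t _; rewrite mul1r mul0r addr0 subrr normc0.
by rewrite mulr_ge0 ?(ltW e0)// exprn_ge0// normc_ge0.
Qed.

Lemma rdiff_ccont A z a b : rdiff A z a b -> ccont A z.
Proof.
move=> /(small_leq (leq0n 1)) h.
have sJ : small 0 (@conjc R).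
  by move=> e e0; exists e => // t /ltW; rewrite normcJ expr0 mulr1.
have := smallD h (smallD (smallMl a (@small_id R)) (smallMl b sJ)).
by apply: eq_small => t /=; ring.
Qed.

(* Derivative of a curve; the real parameter is encoded as the real part of a
   complex one, so that the calculus of [small] applies. *)
Definition vdiff (q : R -> R[i]) (t : R) (c : R[i]) :=
  small 1 (fun s => q (t + Re s) - (q t + c * (Re s)%:C)).

Lemma vdiffP (q : R -> R[i]) (t : R) (c : R[i]) : vdiff q t c <->
  (forall e, 0 < e -> exists2 d, 0 < d & forall h : R, `|h| < d ->
     normc (q (t + h) - (q t + c * h%:C)) <= e * `|h|).
Proof.
split=> H e e0; have [d d0 hd] := H _ e0; exists d => //.
  by move=> h hh; have := hd h%:C; rewrite expr1 normc_real => /(_ hh).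
move=> s sd; have := normr_Re_le s => le; rewrite expr1.
by apply: le_trans (hd _ (le_lt_trans le sd)) _; rewrite ler_wpM2l// ltW.
Qed.

Lemma eq_vdiff q q' t c : q =1 q' -> vdiff q t c -> vdiff q' t c.
Proof. by move=> qq; apply: eq_small => s; rewrite !qq. Qed.

Lemma vdiffB p q t c d : vdiff p t c -> vdiff q t d ->
  vdiff (fun x => p x - q x) t (c - d).
Proof. by move=> h k; apply: eq_small (smallB h k) => s; ring. Qed.

Lemma vdiff_quad (a b : R[i]) (t : R) :
  vdiff (fun x => a * x%:C + b * x%:C ^+ 2) t (a + 2 * b * t%:C).
Proof.
apply/vdiffP => e e0; pose K := normc b + 1.
have K0 : 0 < K by rewrite ltr_wpDl ?normc_ge0.
exists (e / K) => [|h]; first exact: divr_gt0.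
rewrite ltr_pdivlMr// => hh; rewrite rmorphD /=.
rewrite (_ : _ - _ = b * h%:C ^+ 2); last by ring.
rewrite normcM normcX normc_real expr2 mulrA ler_wpM2r//.
by apply: le_trans (ltW hh); rewrite mulrC ler_wpM2l// lerDl.
Qed.

Lemma rdiff_vdiff A (z u : R[i]) (t : R) a b : rdiff A (z + t%:C * u) a b ->
  vdiff (fun s => A (z + s%:C * u)) t (a * u + b * conjc u).
Proof.
move=> H; apply/vdiffP => e e0; pose K := normc u + 1.
have K0 : 0 < K by rewrite ltr_wpDl ?normc_ge0.
have [d d0 hd] := H _ (divr_gt0 e0 K0).
exists (d / K) => [|h]; first exact: divr_gt0.
rewrite ltr_pdivlMr// => hh.
have uK : normc u <= K by rewrite lerDl.
have cJ : conjc (h%:C * u) = h%:C * conjc u.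
  by rewrite rmorphM; congr (_ * _); exact: conjc_real.
have : normc (h%:C * u) < d.
  by rewrite normcM normc_real; apply: le_lt_trans hh; rewrite ler_wpM2l.
move=> /hd; rewrite cJ normcM normc_real -(addrA z) -mulrDl -rmorphD => hd'.
rewrite mulrDl -(mulrA a) -(mulrA b) [u * _]mulrC [conjc u * _]mulrC addrA.
apply: le_trans hd' _.
rewrite expr1 (_ : e / K * _ = e * `|h| * (normc u / K)); last by ring.
by rewrite ler_piMr ?mulr_ge0 ?(ltW e0)// ler_pdivrMr// mul1r.
Qed.

Lemma epsdelta_of_derivable (f : R -> R) (x : R) : derivable f x 1 ->
  forall e, 0 < e -> exists2 d, 0 < d & forall h : R, `|h| < d ->
    `|f (x + h) - (f x + derive1 f x * h)| <= e * `|h|.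
Proof.
move=> /cvgrPdist_lt H e e0; rewrite derive1E /derive.
set l := lim _ in H *.
have := H e e0; rewrite near_withinE => /nbhs_normP[d /= d0] h.
exists d => // t td; have [->|t0] := eqVneq t 0.
  by rewrite mulr0 !addr0 subrr normr0 mulr0.
have tp : 0 < `|t| by rewrite normr_gt0.
have := h t; rewrite /ball_ /= sub0r normrN => /(_ td t0).
rewrite /GRing.scale /= mulr1 [t + x]addrC => /ltW lt.
rewrite -ler_pdivrMr// -normfV -normrM; apply: le_trans lt.
rewrite distrC le_eqVlt; apply/orP; left; apply/eqP.
by congr (`|_|); field.
Qed.

Lemma is_derive_of_epsdelta (f : R -> R) (x c : R) :
  (forall e, 0 < e -> exists2 d, 0 < d & forall h : R, `|h| < d ->
    `|f (x + h) - (f x + c * h)| <= e * `|h|) -> is_derive x 1 f c.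
Proof.
move=> H.
suff cv : (fun h => h^-1 *: ((f \o shift x) (h *: 1) - f x)) @ 0^' --> c.
  by apply: DeriveDef; [apply/cvg_ex; exists c|exact/cvg_lim].
apply/cvgrPdist_le => e /H[d d0 hd].
rewrite near_withinE; apply/nbhs_normP; exists d => // t /=.
rewrite /ball_ /= sub0r normrN => /hd h t0.
have tp : 0 < `|t| by rewrite normr_gt0.
rewrite -(ler_pM2r tp) -normrM; apply: le_trans h.
rewrite -normrN le_eqVlt; apply/orP; left; apply/eqP.
by congr (`|_|); rewrite /GRing.scale /= mulr1 [t + x]addrC; field.
Qed.

(** Rotating [q 1 - q 0] onto the nonnegative real axis by [u] reduces the claim to the real mean
    value theorem for [Re (u q) - phi]. A nonlinear [phi] is what later yields the logarithm. *)
Lemma mean_value_ineq (q dq : R -> R[i]) (phi dphi : R -> R) :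
  (forall t : R, 0 <= t <= 1 -> vdiff q t (dq t)) ->
  (forall t : R, 0 <= t <= 1 -> is_derive t 1 phi (dphi t)) ->
  (forall t : R, 0 <= t <= 1 -> normc (dq t) <= dphi t) ->
  normc (q 1 - q 0) <= phi 1 - phi 0.
Proof.
move=> hq hphi le; have [u u1 uE] := normc_polar (q 1 - q 0).
pose psi := (fun t => Re (u * q t)) - phi.
have dpsi (t : R) : 0 <= t <= 1 -> is_derive t 1 psi (Re (u * dq t) - dphi t).
  move=> t01; apply: is_deriveB; last exact: hphi.
  apply: is_derive_of_epsdelta => e e0.
  have /vdiffP/(_ _ e0)[d d0 hd] := hq _ t01.
  exists d => // h /hd; apply: le_trans.
  rewrite -[X in _ <= X]mul1r -u1 -normcM; apply: le_trans (normr_Re_le _).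
  rewrite le_eqVlt; apply/orP; left; apply/eqP; congr (`|_|).
  by case: (u) (q (t + h)) (q t) (dq t) => ? ? [? ?] [? ?] [? ?] /=; ring.
have [|||c] := @MVT R psi (fun t => Re (u * dq t) - dphi t) 0 1.
- exact: ltr01.
- by move=> x; rewrite in_itv /= => /andP[/ltW x0 /ltW x1]; apply: dpsi; rewrite x0.
- apply: derivable_within_continuous => x; rewrite in_itv /= => /dpsi h.
  exact: ex_derive.
rewrite in_itv /= => /andP[/ltW c0 /ltW c1]; rewrite subr0 mulr1 /psi !fctE => h.
have := le c; rewrite c0 c1 => /(_ isT) lec.
have := Re_le_normc (u * dq c); rewrite normcM u1 mul1r => h2.
have : Re (u * (q 1 - q 0)) = Re (u * q 1) - Re (u * q 0).
  by rewrite mulrBr; case: (u * q 1) (u * q 0) => ? ? [].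
rewrite uE /=; lra.
Qed.

End Differentials.

(** * Continuous partial derivatives *)

Section Partials.
Variable R : realType.
Implicit Types (A F : R[i] -> R[i]) (z a b : R[i]).

Lemma vdiff_of_derivable (q : R -> R[i]) (t : R) :
  derivable (fun s => Re (q s)) t 1 -> derivable (fun s => Im (q s)) t 1 ->
  vdiff q t (derive1 (fun s => Re (q s)) t +i* derive1 (fun s => Im (q s)) t).
Proof.
move=> /epsdelta_of_derivable dr /epsdelta_of_derivable di.
set a := derive1 _ t in dr *; set b := derive1 _ t in di *.
apply/vdiffP => e e0; have e20 : 0 < e / 2 by lra.
have [d d0 hd] := dr _ e20; have [d' d'0 hd'] := di _ e20.
exists (Num.min d d') => [|h]; first by rewrite lt_min d0.
rewrite lt_min => /andP[/hd h1 /hd' h2].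
apply: le_trans (normc_le_ReIm _) _.
rewrite (_ : e * `|h| = e / 2 * `|h| + e / 2 * `|h|); last by field.
move: h1 h2; case: (q (t + h)) (q t) => x y [x' y'] /= h1 h2.
by apply: lerD; [move: h1|move: h2]; congr (`|_| <= _); ring.
Qed.

Lemma vdiff_is_derive (q : R -> R[i]) (t : R) c : vdiff q t c ->
  is_derive t 1 (fun s => Re (q s)) (Re c) /\
  is_derive t 1 (fun s => Im (q s)) (Im c).
Proof.
move=> /vdiffP H; split; apply: is_derive_of_epsdelta => e /H[d d0 hd];
  exists d => // h /hd; apply: le_trans.
  apply: le_trans (normr_Re_le _); case: (q (t + h)) (q t) (c) => x y [x' y'] [u v] /=.
  by rewrite le_eqVlt; apply/orP; left; apply/eqP; congr (`|_|); ring.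
apply: le_trans (normr_Im_le _); case: (q (t + h)) (q t) (c) => x y [x' y'] [u v] /=.
by rewrite le_eqVlt; apply/orP; left; apply/eqP; congr (`|_|); ring.
Qed.

Lemma horE z (s : R) : (0 +i* Im z) + s%:C * 1 = s +i* Im z :> R[i].
Proof. by apply/eqP; rewrite eq_complex /=; apply/andP; split; apply/eqP; ring. Qed.

Lemma verE z (s : R) : (Re z +i* 0) + s%:C * 'i = Re z +i* s :> R[i].
Proof. by apply/eqP; rewrite eq_complex /=; apply/andP; split; apply/eqP; ring. Qed.

Lemma complex_eta z : Re z +i* Im z = z. Proof. by case: z. Qed.

(** The directions [1] and ['i] give [pdx = a + b] and [pdy = 'i (a - b)], which determine [a] and
    [b]. *)
Lemma rdiff_dz A z a b : rdiff A z a b -> dz A z = a /\ dzbar A z = b.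
Proof.
move=> H.
have hx : pdx A z = a + b.
  have : vdiff (fun s => A (s +i* Im z)) (Re z) (a * 1 + b * conjc 1).
    apply: eq_vdiff (rdiff_vdiff (_ : rdiff A (0 +i* Im z + (Re z)%:C * 1) a b)).
      by move=> s; rewrite horE.
    by rewrite horE complex_eta.
  rewrite conjc1 !mulr1 => /vdiff_is_derive[h1 h2].
  rewrite /pdx !derive1E /re_hor /im_hor.
  by rewrite (@derive_val _ _ _ _ _ _ _ h1) (@derive_val _ _ _ _ _ _ _ h2) complex_eta.
have hy : pdy A z = 'i * (a - b).
  have : vdiff (fun s => A (Re z +i* s)) (Im z) (a * 'i + b * conjc 'i).
    apply: eq_vdiff (rdiff_vdiff (_ : rdiff A (Re z +i* 0 + (Im z)%:C * 'i) a b)).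
      by move=> s; rewrite verE.
    by rewrite verE complex_eta.
  have -> : a * 'i + b * conjc 'i = 'i * (a - b).
    by case: a b {H hx} => x y [u v]; apply/eqP; rewrite eq_complex /=;
       apply/andP; split; apply/eqP; ring.
  move=> /vdiff_is_derive[h1 h2].
  rewrite /pdy !derive1E /re_ver /im_ver.
  by rewrite (@derive_val _ _ _ _ _ _ _ h1) (@derive_val _ _ _ _ _ _ _ h2) complex_eta.
have ii : 'i * 'i = -1 :> R[i] by rewrite -expr2 sqr_i.
by split; rewrite /dz /dzbar hx hy mulrA ii; field.
Qed.

Lemma pdx_pdyE F z (t : R[i]) :
  dz F z * t + dzbar F z * conjc t = pdx F z * (Re t)%:C + pdy F z * (Im t)%:C.
Proof.
rewrite /dz /dzbar -!mulrA -mulrDr; apply: (@mulfI _ 2); first by rewrite pnatr_eq0.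
rewrite mulrA divff ?pnatr_eq0// mul1r.
by case: (pdx F z) (pdy F z) t => x y [u v] [c d]; apply/eqP; rewrite eq_complex /=;
  apply/andP; split; apply/eqP; ring.
Qed.

Lemma mean_value_ineq_lin (q dq : R -> R[i]) (c : R[i]) (K : R) :
  (forall t : R, 0 <= t <= 1 -> vdiff q t (dq t)) ->
  (forall t : R, 0 <= t <= 1 -> normc (dq t - c) <= K) ->
  normc (q 1 - q 0 - c) <= K.
Proof.
move=> hq le.
have -> : q 1 - q 0 - c = (q 1 - (c * 1%:C + 0 * 1%:C ^+ 2)) -
    (q 0 - (c * 0%:C + 0 * 0%:C ^+ 2)) by ring.
rewrite (_ : K = K * 1 - K * 0); last by ring.
apply: (@mean_value_ineq _ (fun s => q s - (c * s%:C + 0 * s%:C ^+ 2))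
  (fun s => dq s - c) (fun s => K * s) (fun=> K)) => t t01.
- by have := vdiffB (hq _ t01) (vdiff_quad c 0 t); rewrite mulr0 mul0r addr0.
- apply: is_derive_of_epsdelta => e e0; exists 1 => // h _.
  by rewrite mulrDr subrr normr0 mulr_ge0// ltW.
- exact: le.
Qed.

Lemma vdiff_affine (q : R -> R[i]) (a b s : R) c : vdiff q (a + s * b) c ->
  vdiff (fun s => q (a + s * b)) s (c * b%:C).
Proof.
move=> /vdiffP H; apply/vdiffP => e e0; pose K := `|b| + 1.
have K0 : 0 < K by rewrite ltr_wpDl.
have [d d0 hd] := H _ (divr_gt0 e0 K0).
exists (d / K) => [|h]; first exact: divr_gt0.
rewrite ltr_pdivlMr// => hh.
have bK : `|b| <= K by rewrite lerDl.
have : `|h * b| < d.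
  by rewrite normrM; apply: le_lt_trans hh; rewrite ler_wpM2l.
move=> /hd; rewrite -addrA -mulrDl => hd'.
rewrite -mulrA -rmorphM [b * h]mulrC; apply: le_trans hd' _.
rewrite normrM (_ : e / K * _ = e * `|h| * (`|b| / K)); last by ring.
by rewrite ler_piMr ?mulr_ge0 ?(ltW e0)// ler_pdivrMr// mul1r.
Qed.

Lemma hor_vdiff A z (x s : R) : has_partials_at A (z + s%:C * x%:C) ->
  vdiff (fun s => A (z + s%:C * x%:C)) s (pdx A (z + s%:C * x%:C) * x%:C).
Proof.
have E r : z + r%:C * x%:C = (Re z + r * x) +i* Im z.
  by case: z => u v; apply/eqP; rewrite eq_complex /=; apply/andP; split; apply/eqP; ring.
rewrite E => -[h1 h2 _ _].
have := @vdiff_affine (fun r => A (r +i* Im z)) (Re z) x s _ (vdiff_of_derivable h1 h2).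
by apply: eq_vdiff => r; rewrite E.
Qed.

Lemma ver_vdiff A z (x s : R) : has_partials_at A (z + 'i * (s%:C * x%:C)) ->
  vdiff (fun s => A (z + 'i * (s%:C * x%:C))) s (pdy A (z + 'i * (s%:C * x%:C)) * x%:C).
Proof.
have E r : z + 'i * (r%:C * x%:C) = Re z +i* (Im z + r * x).
  by case: z => u v; apply/eqP; rewrite eq_complex /=; apply/andP; split; apply/eqP; ring.
rewrite E => -[_ _ h1 h2].
have := @vdiff_affine (fun r => A (Re z +i* r)) (Im z) x s _ (vdiff_of_derivable h1 h2).
by apply: eq_vdiff => r; rewrite E.
Qed.

(** Go from [z] vertically to [w], then horizontally to [z + t]. Both legs stay within [normc t] of
    [z] ([shape]), where each partial derivative differs from its value at [z] by at most
    [e / 2]. *)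
Lemma C1_rdiff (D : set R[i]) A z (d : R) : 0 < d ->
  (forall t, normc t < d -> D (z + t)) -> C1_on D A ->
  rdiff A z (dz A z) (dzbar A z).
Proof.
move=> d0 zD [hp cx cy] e e0.
have Dz : D z by have := zD 0; rewrite normc0 addr0; apply.
have e20 : 0 < e / 2 by lra.
have [dx dx0 hx] := ccont_of_continuous (cx _ Dz) e20.
have [dy dy0 hy] := ccont_of_continuous (cy _ Dz) e20.
exists (Num.min d (Num.min dx dy)) => [|t]; first by rewrite !lt_min d0 dx0.
rewrite !lt_min => /and3P[td tx ty].
rewrite -addrA pdx_pdyE expr1.
set x := Re t; set y := Im t.
have xt : `|x| <= normc t := normr_Re_le t.
have yt : `|y| <= normc t := normr_Im_le t.
have shape (s : R) : 0 <= s <= 1 -> normc ('i * y%:C + s%:C * x%:C) <= normc t /\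
    normc ('i * (s%:C * y%:C)) <= normc t.
  move=> /andP[s0 s1]; have s2 : s ^+ 2 <= 1 by rewrite exprn_ile1.
  rewrite !ler_normc_sqr ?normc_ge0// !sqr_normc_ReIm /= -/x -/y.
  by have := sqr_ge0 x; have := sqr_ge0 y; split; nra.
pose w := z + 'i * y%:C.
have H1 : normc (A (z + t) - A w - pdx A z * x%:C) <= e / 2 * normc t.
  have := @mean_value_ineq_lin (fun s => A (w + s%:C * x%:C))
    (fun s => pdx A (w + s%:C * x%:C) * x%:C) (pdx A z * x%:C) (e / 2 * normc t).
  rewrite mul0r addr0 (_ : w + _ = z + t); last first.
    by rewrite /w /x /y; case: (z) (t) => ? ? [u v]; apply/eqP; rewrite eq_complex /=;
      apply/andP; split; apply/eqP; ring.
  apply => s /shape[st _]; rewrite /w -addrA.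
    by rewrite addrA; apply: hor_vdiff; rewrite -addrA; apply: hp; apply: zD; exact: le_lt_trans td.
  rewrite -mulrBl normcM normc_real; apply: ler_pM; rewrite ?normc_ge0//.
  by have := hx _ (le_lt_trans st tx); rewrite expr0 mulr1.
have H2 : normc (A w - A z - pdy A z * y%:C) <= e / 2 * normc t.
  have := @mean_value_ineq_lin (fun s => A (z + 'i * (s%:C * y%:C)))
    (fun s => pdy A (z + 'i * (s%:C * y%:C)) * y%:C) (pdy A z * y%:C) (e / 2 * normc t).
  rewrite mul0r mulr0 addr0 mul1r -/w; apply => s /shape[_ st].
    by apply: ver_vdiff; apply: hp; apply: zD; exact: le_lt_trans td.
  rewrite -mulrBl normcM normc_real; apply: ler_pM; rewrite ?normc_ge0//.
  by have := hy _ (le_lt_trans st ty); rewrite expr0 mulr1.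
have := ler_normcD (A (z + t) - A w - pdx A z * x%:C) (A w - A z - pdy A z * y%:C).
rewrite (_ : _ + (_ - pdy A z * _) = A (z + t) - (A z + (pdx A z * x%:C + pdy A z * y%:C))).
  lra.
ring.
Qed.

(* Integrating the expansion of [F = P'] along the two paths from [z] to
   [z + rho + i rho] with sides parallel to the axes shows that [F] satisfies the
   Cauchy-Riemann equations at [z]. *)
Lemma expand2_primitive P F z a b (d : R) : 0 < d ->
  (forall t, normc t < d -> rdiff P (z + t) (F (z + t)) 0) -> rdiff F z a b ->
  expand2 P z.
Proof.
move=> d0 hP hF.
(* The polynomial is the integral, over the segment from [z + s] to [z + s + t], of the first-order
   expansion of [F] at [z]. Taking [s = 0] will give the expansion of [P]. *)
have step e : 0 < e -> exists2 d', 0 < d' & forall s t, normc s + normc t < d' ->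
    normc (P (z + s + t) - P (z + s) - (F z * t + (a * s + b * conjc s) * t +
      (a * t + b * conjc t) * t / 2)) <= e * (normc s + normc t) * normc t.
  move=> e0; have [d1 d10 h1] := hF _ e0.
  exists (Num.min d d1) => [|s t]; first by rewrite lt_min d0.
  rewrite lt_min => /andP[std std1].
  pose q (r : R) := P (z + s + r%:C * t) -
     ((F z * t + (a * s + b * conjc s) * t) * r%:C +
     ((a * t + b * conjc t) * t / 2) * r%:C ^+ 2).
  have := @mean_value_ineq_lin q (fun r => F (z + s + r%:C * t) * t -
    ((F z * t + (a * s + b * conjc s) * t) + 2 * ((a * t + b * conjc t) * t / 2) * r%:C))
    0 (e * (normc s + normc t) * normc t).
  rewrite subr0 /q mul1r mul0r addr0 expr1n expr0n /= !mulr0 !mulr1 !addr0 subr0.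
  rewrite -addrA -opprD [X in _ - X]addrC opprD addrA.
  rewrite -addrA => H; apply: le_trans (H _ _) => {H}.
  - by rewrite le_eqVlt; apply/orP; left; apply/eqP; congr normc; ring.
  - move=> r /andP[r0 r1]; apply: vdiffB; last exact: vdiff_quad.
    have rt : normc (s + r%:C * t) < d.
      apply: le_lt_trans std; apply: le_trans (ler_normcD _ _) _.
      by rewrite normcM normc_real ger0_norm// lerD2l ler_piMl// normc_ge0.
    have := hP _ rt; rewrite addrA => /rdiff_vdiff.
    by rewrite mul0r addr0.
  - move=> r /andP[r0 r1].
    have rt : normc (s + r%:C * t) <= normc s + normc t.
      apply: le_trans (ler_normcD _ _) _.
      by rewrite normcM normc_real ger0_norm// lerD2l ler_piMl// normc_ge0.
    have := h1 _ (le_lt_trans rt std1); rewrite expr1 => h.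
    have cE : conjc (s + r%:C * t) = conjc s + r%:C * conjc t.
      by rewrite rmorphD rmorphM; congr (_ + _ * _); exact: conjc_real.
    rewrite subr0 (_ : _ - _ = (F (z + (s + r%:C * t)) -
      (F z + a * (s + r%:C * t) + b * conjc (s + r%:C * t))) * t); last first.
      by rewrite cE -addrA; field.
    rewrite normcM ler_wpM2r ?normc_ge0//; apply: le_trans h _.
    by rewrite ler_wpM2l// ltW.
have b0 : b = 0.
  apply: eq0_normc; apply/eqP; rewrite eq_le normc_ge0 andbT.
  apply/ler_addgt0Pr => e e0; rewrite add0r.
  (* The four sides have errors [r^2], [2 r^2], [r^2], [2 r^2] times the tolerance; [e / 3] makes
     the sum [2 e r^2], to be compared with [2 |b| r^2]. *)
  have [|d' d'0 H] := step (e / 3); first lra.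
  pose r := d' / 3; have r0 : 0 < r by rewrite /r; lra.
  have nr : normc r%:C = r by rewrite normc_real gtr0_norm.
  have ni : normc ('i * r%:C) = r by rewrite normcM normc_i mul1r.
  have H1 := H 0 r%:C; have H2 := H r%:C ('i * r%:C).
  have H3 := H 0 ('i * r%:C); have H4 := H ('i * r%:C) r%:C.
  move: H1 H2 H3 H4; rewrite normc0 nr ni !addr0 !add0r.
  have rd : r < d' by rewrite /r; lra.
  have r2d : r + r < d' by rewrite /r; lra.
  move=> /(_ rd) H1 /(_ r2d) H2 /(_ rd) H3 /(_ r2d) H4.
  have c0 : conjc 0 = 0 :> R[i] by exact: conjc0.
  have cr : conjc r%:C = r%:C by exact: conjc_real.
  have ci : conjc ('i * r%:C) = - ('i * r%:C).
    by apply/eqP; rewrite eq_complex /=; apply/andP; split; apply/eqP; ring.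
  have := lerD (lerD H1 H2) (lerD H3 H4); rewrite c0 cr ci.
  set E1 := (X in normc X + _ + _); set E2 := (X in _ + normc X + _).
  set E3 := (X in _ + (normc X + _)); set E4 := (X in _ + (_ + normc X)).
  have EE : E1 + E2 - (E3 + E4) = - (2 * b * 'i * r%:C ^+ 2).
    by rewrite /E1 /E2 /E3 /E4 (addrAC z ('i * r%:C)); field.
  have : normc (E1 + E2 - (E3 + E4)) <= normc E1 + normc E2 + (normc E3 + normc E4).
    apply: le_trans (ler_normcB _ _) _.
    by apply: lerD; exact: ler_normcD.
  have n2 : normc (2 : R[i]) = 2.
    by rewrite (_ : 2 = 2%:C) ?normc_real ?ger0_norm// rmorphMn.
  rewrite EE normc_opp normcM normcX nr !normcM normc_i mulr1 n2 => k1 k2.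
  have k : normc b * (2 * r ^+ 2) <= e * (2 * r ^+ 2) by nra.
  by move: k; rewrite ler_pM2r// mulr_gt0// exprn_gt0.
exists (F z), (a / 2) => e e0; have [d' d'0 H] := step _ e0.
exists d' => // t td; have := H 0 t; rewrite normc0 add0r => /(_ td).
rewrite addr0 b0; congr (_ <= _); last by rewrite expr2 mulrA.
by congr normc; field.
Qed.

End Partials.

(** * Schwarz-Pick for derivatives *)

Section Primitive.
Variable R : realType.
Implicit Types (z : R[i]).

(** This turns a sum of two moduli, such as [|dz f| + |dzbar f|], into the modulus of one linear
    combination, to which complex analysis applies. *)
Lemma normc_align (a b : R[i]) : exists2 c, normc c = 1 &
  normc (a + c * b) = normc a + normc b.
Proof.
have [u u1 ua] := normc_polar a; have [v v1 vb] := normc_polar b.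
have u0 : u != 0 by rewrite -normc_gt0 u1.
exists (v / u); first by rewrite normcM normcV u1 v1 invr1 mulr1.
rewrite -[LHS]mul1r -u1 -normcM.
have -> : u * (a + v / u * b) = u * a + v * b by field.
by rewrite ua vb -rmorphD normc_real ger0_norm// addr_ge0 ?normc_ge0.
Qed.

Lemma le_normc_diff_quotient (P F : R[i] -> R[i]) z (t : R[i]) (M : R) : t != 0 ->
  (forall s : R, 0 <= s <= 1 -> rdiff P (z + s%:C * t) (F (z + s%:C * t)) 0) ->
  (forall s : R, 0 <= s <= 1 -> normc (F (z + s%:C * t)) <= M) ->
  normc ((P (z + t) - P z) / t) <= M.
Proof.
move=> t0 hP hF.
rewrite normcM normcV ler_pdivrMr ?normc_gt0//.
have := @mean_value_ineq_lin R (fun s => P (z + s%:C * t))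
  (fun s => F (z + s%:C * t) * t) 0 (M * normc t).
rewrite mul1r mul0r addr0 subr0; apply => s s01.
  by have := rdiff_vdiff (hP _ s01); rewrite mul0r addr0.
by rewrite subr0 normcM ler_wpM2r ?normc_ge0// hF.
Qed.

(* Schwarz-Pick for a derivative [F = P'], with no regularity of [F]: apply it to
   the difference quotients of [P], which have the same bound [M]. *)
Lemma schwarz_pick_primitive (P F : R[i] -> R[i]) (M : R) : 0 < M ->
  (forall z, normc z < 1 -> rdiff P z (F z) 0) ->
  (forall z, normc z < 1 -> expand2 P z) ->
  (forall z, normc z < 1 -> normc (F z) <= M) ->
  forall z, normc z < 1 ->
    M * (1 - normc z) * normc (F z - F 0) <= normc z * (M ^+ 2 - normc (F 0) ^+ 2).
Proof.
move=> M0 hP eP bF z z1.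
apply/ler_addgt0Pr => e e0.
(* The losses below are [2 M n] in [k1], [2 M^2 n] in [k2] and [2 M n] in [k3]. *)
have C0 : 0 < 4 * M + 2 * M ^+ 2 by rewrite addr_gt0 ?mulr_gt0 ?exprn_gt0.
pose n := e / (4 * M + 2 * M ^+ 2); have n0 : 0 < n by rewrite divr_gt0.
have nE : (4 * M + 2 * M ^+ 2) * n = e by rewrite /n mulrC divfK// gt_eqF.
have n01 : normc 0 < 1 :> R by rewrite normc0.
have [d1 d10 h1] := hP _ z1 n n0; have [d2 d20 h2] := hP _ n01 n n0.
pose s := Num.min (Num.min d1 d2) (Num.min (1 - normc z) n) / 2.
have m0 : 0 < Num.min (Num.min d1 d2) (Num.min (1 - normc z) n).
  by rewrite !lt_min d10 d20 n0 subr_gt0 z1.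
have s0 : 0 < s by rewrite divr_gt0.
have : s < Num.min (Num.min d1 d2) (Num.min (1 - normc z) n).
  by rewrite /s ltr_pdivrMr// ltr_pMr// ltr1n.
rewrite !lt_min => /andP[/andP[sd1 sd2] /andP[sz sn]].
clearbody s; clearbody n; clear m0.
have ns : normc s%:C = s by rewrite normc_real gtr0_norm.
have sC0 : s%:C != 0 :> R[i] by rewrite -normc_gt0 ns.
pose G x := (P (x + s%:C) - P x) / s%:C.
have GF x : normc (P (x + s%:C) - (P x + F x * s%:C + 0 * conjc s%:C)) <= n * s ->
    normc (G x - F x) <= n.
  rewrite mul0r addr0 => h.
  rewrite (_ : G x - F x = (P (x + s%:C) - (P x + F x * s%:C)) / s%:C).
    by rewrite normcM normcV ns ler_pdivrMr.
  by rewrite /G; field.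
have := h1 s%:C; rewrite ns expr1 => /(_ sd1)/GF g1.
have := h2 s%:C; rewrite ns expr1 => /(_ sd2)/GF g2.
(* The radius is [1 - s] because both [x] and [x + s] must lie in the unit disk. *)
have sP : M * (1 - s - normc z) * normc (G z - G 0) <=
    normc z * (M ^+ 2 - normc (G 0) ^+ 2).
  apply: schwarz_pick => //; last by rewrite ltrBrDr -ltrBrDl.
  - move=> x xs; have xs1 : normc (x + s%:C) < 1.
      by apply: le_lt_trans (ler_normcD _ _) _; rewrite ns -ltrBrDr.
    have x1 : normc x < 1 by apply: lt_trans xs _; rewrite gtrBl.
    have [b [c h]] := expand2M (expand2_cst (-1) x) (eP _ x1).
    apply: expand2M (expand2_cst _ _).
    apply: expand2D; first exact: expand2_shift (eP _ xs1).
    by exists b, c; apply: eq_small h => t; rewrite !mulN1r.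
  - move=> x xs; have xr (r : R) : 0 <= r <= 1 -> normc (x + r%:C * s%:C) < 1.
      move=> /andP[r0 r1]; apply: le_lt_trans (ler_normcD _ _) _.
      rewrite normcM ns normc_real ger0_norm//.
      have : r * s <= s by rewrite ler_piMl// ltW.
      by move: xs; lra.
    by apply: (@le_normc_diff_quotient P F) => // r /xr; [exact: hP|exact: bF].
have z0 := normc_ge0 z.
have X : normc (F z - F 0) <= normc (G z - G 0) + 2 * n.
  rewrite (_ : F z - F 0 = (G z - G 0) - ((G z - F z) - (G 0 - F 0))); last by ring.
  apply: le_trans (ler_normcB _ _) _; rewrite lerD2l.
  by apply: le_trans (ler_normcB _ _) _; lra.
have X2 : normc (F z - F 0) <= 2 * M.
  by apply: le_trans (ler_normcB _ _) _; have := bF _ z1; have := bF _ n01; lra.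
have Y : normc (F 0) <= normc (G 0) + n.
  rewrite (_ : F 0 = G 0 - (G 0 - F 0)); last by ring.
  by apply: le_trans (ler_normcB _ _) _; lra.
have Y0 := normc_ge0 (G 0); have F0 := normc_ge0 (F 0); have F1 := bF _ n01.
have Y2 : normc (F 0) ^+ 2 - 2 * M * n <= normc (G 0) ^+ 2.
  by have [h|h] := leP (normc (F 0)) n; nra.
set X' := normc (G z - G 0) in X sP *; set x := normc (F z - F 0) in X X2 *.
set y := normc (F 0) in Y2 *; set y' := normc (G 0) in Y2 sP.
have k1 : M * (1 - s - normc z) * x <= M * (1 - s - normc z) * X' + 2 * M * n.
  apply: le_trans (_ : M * (1 - s - normc z) * (X' + 2 * n) <= _).
    by rewrite ler_wpM2l// mulr_ge0 ?(ltW M0)//; lra.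
  rewrite mulrDr lerD2l.
  have : M * n * (1 - s - normc z) <= M * n * 1.
    by rewrite ler_wpM2l ?mulr_ge0 ?(ltW M0) ?(ltW n0)//; lra.
  lra.
have k2 : M * s * x <= M * n * (2 * M).
  by apply: ler_pM; rewrite ?mulr_ge0 ?(ltW M0) ?(ltW s0) ?normc_ge0// ler_wpM2l ?(ltW M0) ?(ltW sn).
have k3 : normc z * (M ^+ 2 - y' ^+ 2) <= normc z * (M ^+ 2 - y ^+ 2) + 2 * M * n.
  apply: le_trans (_ : normc z * (M ^+ 2 - y ^+ 2 + 2 * M * n) <= _).
    by rewrite ler_wpM2l//; lra.
  rewrite mulrDr lerD2l; apply: ler_piMl; last exact: ltW.
  by rewrite !mulr_ge0 ?(ltW M0) ?(ltW n0).
nra.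
Qed.

End Primitive.

(** * Pointwise consequence of ellipticity *)

Section Elliptic.
Variable R : realType.
Implicit Types (F : R[i] -> R[i]) (z : R[i]).

Definition vec2c (v : 'cV[R]_2) : R[i] := v 0 0 +i* v 1 0.

Lemma enorm_vec2c v : enorm v = normc (vec2c v).
Proof. by rewrite /enorm big_ord_recl big_ord1 /vec2c /= (_ : lift _ _ = 1)//; exact: val_inj. Qed.

Lemma vec2c_diff_mx F z v : vec2c (diff_mx F z *m v) =
  dz F z * vec2c v + dzbar F z * conjc (vec2c v).
Proof.
rewrite pdx_pdyE /vec2c !mxE !big_ord_recl !big_ord0 !mxE.
rewrite (_ : lift _ _ = 1); last exact: val_inj.
change (v ord0 0) with (v 0 0); move: (v 0 0) (v 1 0) => x y.
by case: (pdx F z) (pdy F z) => a b [c d]; apply/eqP; rewrite eq_complex /=;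
  apply/andP; split; apply/eqP; ring.
Qed.

(** With [c] aligning the two derivatives and [w^2 = c], the unit vector [conjc w] is mapped to
    [conjc w (dz F z + c dzbar F z)], of modulus [|dz F z| + |dzbar F z|]. *)
Lemma opnorm_diff_mx_ge F z :
  normc (dz F z) + normc (dzbar F z) <= opnorm (diff_mx F z).
Proof.
have [c c1 cE] := normc_align (dz F z) (dzbar F z).
pose w := sqrtc c.
have w2 : w ^+ 2 = c by exact: sqr_sqrtc.
have w1 : normc w = 1.
  apply/eqP; rewrite -(@pexpr_eq1 _ _ 2) ?normc_ge0//.
  by rewrite -normcX w2 c1.
apply: ub_le_sup.
  exists (normc (dz F z) + normc (dzbar F z)) => _ [v /= v1 <-].
  rewrite enorm_vec2c vec2c_diff_mx; apply: le_trans (ler_normcD _ _) _.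
  by rewrite [normc (_ * vec2c v)]normcM [normc (_ * conjc _)]normcM normcJ
    -enorm_vec2c v1 !mulr1.
pose v : 'cV[R]_2 := \col_j (if j == 0 then Re w else - Im w).
have vE : vec2c v = conjc w by rewrite /vec2c !mxE /=; case: (w).
exists v; first by rewrite /= enorm_vec2c vE normcJ.
rewrite enorm_vec2c vec2c_diff_mx vE -cE conjcK.
have ww : conjc w * w = 1.
  by rewrite mulrC mulcJ w1 expr1n.
have -> : dz F z * conjc w + dzbar F z * w =
    conjc w * (dz F z + c * dzbar F z).
  rewrite -w2 -[X in _ + X]mul1r -ww; ring.
by rewrite normcM normcJ w1 mul1r.
Qed.

(** A square of side [r / 2] centred at [z] has positive measure, so it cannot lie in a null set. *)
Lemma ae_exists_near (P : R[i] -> Prop) z (r : R) : 0 < r ->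
  {ae (@lebesgue_measure R \x @lebesgue_measure R)%E, forall p, P (plane_point p)} ->
  exists2 t, normc t < r & P (z + t).
Proof.
move=> r0 [N [mN N0 hN]]; apply: contrapT => nex.
pose I (c : R) : set (measurableTypeR R) := `[c - r / 4, c + r / 4]%classic.
have sub : I (Re z) `*` I (Im z) `<=` N.
  move=> [x y] /= [hx hy]; apply: hN => /= Pxy; apply: nex.
  exists ((x +i* y) - z); last by rewrite addrC subrK.
  move: hx hy; rewrite /I /= !in_itv /= => hx hy.
  apply: le_lt_trans (normc_le_ReIm _) _.
  have : `|x - Re z| <= r / 4 by rewrite ler_norml; lra.
  have : `|y - Im z| <= r / 4 by rewrite ler_norml; lra.
  by case: (z) => a b /=; lra.
have mI c : measurable (I c) by exact: measurable_itv.
have mII := measurableX (mI (Re z)) (mI (Im z)).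
have : ((@lebesgue_measure R \x @lebesgue_measure R) (I (Re z) `*` I (Im z)) <=
        (@lebesgue_measure R \x @lebesgue_measure R) N)%E.
  by apply: le_measure; rewrite ?inE.
rewrite N0 product_measure1E//.
have lI c : lebesgue_measure (I c) = (r / 2)%:E.
  rewrite lebesgue_measure_itv /= lte_fin ifT; last lra.
  by rewrite -EFinD; congr EFin; field.
move=> le; have : ((r / 2)%:E * (r / 2)%:E <= 0 :> \bar R)%E.
  by rewrite -{1}(lI (Re z)) -(lI (Im z)); exact: le.
by rewrite -EFinM lee_fin leNgt mulr_gt0//; lra.
Qed.

Lemma ccont_dz (D : set R[i]) F z : C1_on D F -> D z ->
  ccont (dz F) z /\ ccont (dzbar F) z.
Proof.
move=> [_ cx cy] Dz.
have hx := ccont_of_continuous (cx _ Dz).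
have hy := ccontM (ccont_cst 'i z) (ccont_of_continuous (cy _ Dz)).
split; apply: ccontM (ccont_cst _ _) _; apply: ccontD hx _ => //.
by apply: eq_small (ccontM (ccont_cst (-1) z) hy) => t; rewrite !mulN1r.
Qed.

(** A violation at [z] persists nearby by continuity, hence at a point where the ellipticity
    inequality holds. There [A^2 - B^2 <= lam (A + B)] needs only [A - B <= lam], whatever the sign
    of the Jacobian. *)
Lemma elliptic_dilatation_le (K K' lam M : R) F : 1 <= K -> 0 < M ->
  K * lam <= M -> M ^+ 2 = K * lam * M + K' ->
  C1_on (disk 1) F ->
  ae_on (disk 1) (fun z => opnorm (diff_mx F z) ^+ 2 <= K * Defs.jacobian F z + K') ->
  (forall z, disk 1 z -> lambda_min F z <= lam) ->
  forall z, disk 1 z -> normc (dz F z) + normc (dzbar F z) <= M.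
Proof.
move=> K1 M0 KM M2 C1 ae hlam z z1; rewrite leNgt; apply/negP => gtM.
have [cA cB] := ccont_dz C1 z1.
(* One third of the excess: each of the two moduli drops by at most [e], so the sum still exceeds
   [M]. *)
pose e := (normc (dz F z) + normc (dzbar F z) - M) / 3.
have e0 : 0 < e by rewrite divr_gt0// subr_gt0.
have [d1 d10 h1] := cA _ e0; have [d2 d20 h2] := cB _ e0.
have z1' : 0 < 1 - normc z by rewrite subr_gt0.
have d0 : 0 < Num.min (Num.min d1 d2) (1 - normc z).
  by rewrite !lt_min d10 d20.
have [t] := @ae_exists_near (fun x => disk 1 x ->
  opnorm (diff_mx F x) ^+ 2 <= K * Defs.jacobian F x + K') z _ d0 ae.
rewrite !lt_min => /andP[/andP[/h1 t1 /h2 t2] tz].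
have zt : disk 1 (z + t).
  by apply: le_lt_trans (ler_normcD _ _) _; rewrite -ltrBrDl.
move=> /(_ zt) el; have := hlam _ zt.
move: t1 t2 el; rewrite expr0 !mulr1 /lambda_min /Defs.jacobian.
have := opnorm_diff_mx_ge F (z + t).
have := ler_sub_normcD (dz F z) (dz F (z + t) - dz F z).
have := ler_sub_normcD (dzbar F z) (dzbar F (z + t) - dzbar F z).
rewrite [dz F z + _]addrC subrK [dzbar F z + _]addrC subrK.
have A0 := normc_ge0 (dz F (z + t)); have B0 := normc_ge0 (dzbar F (z + t)).
move: A0 B0; set A := normc (dz F (z + t)); set B := normc (dzbar F (z + t)).
move=> A0 B0 hB hA op t1 t2 el hl.
have eE : 3 * e = normc (dz F z) + normc (dzbar F z) - M by rewrite /e; field.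
clearbody e; have AB : M < A + B by lra.
have op2 : (A + B) ^+ 2 <= opnorm (diff_mx F (z + t)) ^+ 2.
  by rewrite ler_pXn2r ?nnegrE//; lra.
have AmB : A - B <= lam by apply: le_trans (ler_norm _) hl.
have J : A ^+ 2 - B ^+ 2 <= lam * (A + B).
  rewrite (_ : A ^+ 2 - B ^+ 2 = (A - B) * (A + B)); last by ring.
  by rewrite ler_wpM2r// addr_ge0.
have : K * (A ^+ 2 - B ^+ 2) <= K * (lam * (A + B)).
  by rewrite ler_wpM2l//; lra.
(* For [x = A + B] this product equals [x^2 - K lam x - K'], since [M] is a root of that
   polynomial. *)
have : 0 < (A + B - M) * (A + B + M - K * lam).
  by rewrite mulr_gt0//; lra.
move: op2 el; set x := A + B; nra.
Qed.

End Elliptic.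

(** * Univalence and covering radii *)

Section Univalence.
Variable R : realType.
Implicit Types (f A B : R[i] -> R[i]) (p q w z : R[i]).

Definition rlin p q z := p * z + q * conjc z.
(** Cramer's rule for [rlin p q z = w] together with its conjugate equation; the denominator is the
    determinant [|p|^2 - |q|^2]. *)
Definition rlin_inv p q w := (conjc p * w - q * conjc w) / (p * conjc p - q * conjc q).

Lemma rlinB p q z w : rlin p q (z - w) = rlin p q z - rlin p q w.
Proof. by rewrite /rlin rmorphB; ring. Qed.

Lemma rlin_invB p q z w : rlin_inv p q (z - w) = rlin_inv p q z - rlin_inv p q w.
Proof. by rewrite /rlin_inv rmorphB; ring. Qed.

Lemma normc_rlin_ge p q z : `|normc p - normc q| = 1 -> normc z <= normc (rlin p q z).
Proof.
move=> pq; rewrite -[leLHS]mul1r -pq -[X in _ * X <= _]ger0_norm ?normc_ge0//.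
rewrite -normrM mulrBl ler_norml.
have h1 := ler_sub_normcD (p * z) (q * conjc z).
have h2 := ler_sub_normcD (q * conjc z) (p * z).
rewrite [q * _ + _]addrC in h2; move: h1 h2; rewrite !normcM normcJ /rlin; lra.
Qed.

Lemma normc_det p q : `|normc p - normc q| = 1 ->
  normc (p * conjc p - q * conjc q) = normc p + normc q.
Proof.
move=> pq; rewrite !mulcJ -rmorphB normc_real.
rewrite (_ : _ - _ = (normc p - normc q) * (normc p + normc q)); last by ring.
by rewrite normrM pq mul1r ger0_norm// addr_ge0 ?normc_ge0.
Qed.

Lemma det_gt0 p q : `|normc p - normc q| = 1 -> 0 < normc p + normc q.
Proof.
move=> pq; apply: lt_le_trans ltr01 _; rewrite -pq.
apply: le_trans (ler_normB _ _) _; by rewrite !ger0_norm ?normc_ge0.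
Qed.

Lemma rlin_invK p q w : `|normc p - normc q| = 1 -> rlin p q (rlin_inv p q w) = w.
Proof.
move=> pq; have D0 : p * conjc p - q * conjc q != 0.
  by rewrite -normc_gt0 normc_det// det_gt0.
rewrite /rlin /rlin_inv !(rmorphM, fmorphV, rmorphB) /= !conjcK.
rewrite [conjc p * p]mulrC [conjc q * q]mulrC; field.
exact: D0.
Qed.

(** The numerator is at most [(|p| + |q|) |w|], and the determinant has modulus exactly
    [|p| + |q|]. *)
Lemma normc_rlin_inv_le p q w : `|normc p - normc q| = 1 ->
  normc (rlin_inv p q w) <= normc w.
Proof.
move=> pq; rewrite normcM normcV normc_det// ler_pdivrMr ?det_gt0//.
apply: le_trans (ler_normcB _ _) _; rewrite !normcM !normcJ; lra.
Qed.

Section Harmonic.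
Variables (f A B : R[i] -> R[i]) (a : R).
Hypothesis a0 : 0 <= a.
Hypothesis df : forall z, normc z < 1 -> rdiff f z (A z) (B z).
Hypothesis dAB : forall z, normc z < 1 ->
  (1 - normc z) * (normc (A z - A 0) + normc (B z - B 0)) <= a * normc z.
Hypothesis AB0 : `|normc (A 0) - normc (B 0)| = 1.
Hypothesis f0 : f 0 = 0.

Let dev z := f z - rlin (A 0) (B 0) z.

Lemma dev_rdiff z : normc z < 1 -> rdiff dev z (A z - A 0) (B z - B 0).
Proof.
move=> /df h; have h2 := rdiffD (rdiffZ (A 0) (rdiff_id z)) (rdiffZ (B 0) (rdiffJ (rdiff_id z))).
have := rdiffD h (rdiffZ (-1) h2).
rewrite conjc1 conjc0 !mulr0 !mulr1 addr0 add0r !mulN1r.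
by apply: eq_rdiff => x; rewrite /dev /rlin mulN1r.
Qed.

(** On the convex disk [|z| <= r] the differential of [dev] has norm at most [a r / (1 - r)]. *)
Lemma dev_lipschitz (r : R) z1 z2 : r < 1 -> normc z1 <= r -> normc z2 <= r ->
  (1 - r) * normc (dev z1 - dev z2) <= a * r * normc (z1 - z2).
Proof.
move=> r1 h1 h2; have r10 : 0 < 1 - r by rewrite subr_gt0.
rewrite mulrC -ler_pdivlMr// mulrAC.
have := @mean_value_ineq_lin R (fun s => dev (z2 + s%:C * (z1 - z2)))
  (fun s => (A (z2 + s%:C * (z1 - z2)) - A 0) * (z1 - z2) +
            (B (z2 + s%:C * (z1 - z2)) - B 0) * conjc (z1 - z2))
  0 (a * r / (1 - r) * normc (z1 - z2)).
rewrite mul1r mul0r addr0 subr0 [z2 + _]addrC subrK.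
have seg (s : R) : 0 <= s <= 1 -> normc (z2 + s%:C * (z1 - z2)) <= r.
  move=> /andP[s0 s1].
  rewrite (_ : _ + _ = (1 - s)%:C * z2 + s%:C * z1); last by rewrite rmorphB; ring.
  apply: le_trans (ler_normcD _ _) _; rewrite !normcM !normc_real !ger0_norm//; last lra.
  have : (1 - s) * normc z2 <= (1 - s) * r by rewrite ler_wpM2l// subr_ge0.
  have : s * normc z1 <= s * r by rewrite ler_wpM2l.
  lra.
apply => s /seg zr.
  by apply: rdiff_vdiff; apply: dev_rdiff; exact: le_lt_trans r1.
rewrite subr0; apply: le_trans (ler_normcD _ _) _.
rewrite !normcM normcJ -mulrDl ler_wpM2r ?normc_ge0// ler_pdivlMr//.
set z := z2 + _ in zr *; have := dAB (le_lt_trans zr r1).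
have := normc_ge0 (A z - A 0); have := normc_ge0 (B z - B 0).
set x := normc (A z - _); set y := normc (B z - _) => x0 y0 h.
apply: le_trans (_ : a * normc z <= _); last by rewrite ler_wpM2l.
by apply: le_trans h; rewrite mulrC ler_wpM2r ?addr_ge0//; lra.
Qed.

(** The right-hand side is the integral of [a t / (1 - t)] from [0] to [|z|]. *)
Lemma dev_growth z : normc z < 1 ->
  normc (dev z) <= - a * (normc z + ln (1 - normc z)).
Proof.
move=> z1; set r := normc z in z1 *; have r0 : 0 <= r := normc_ge0 z.
have dev0 : dev 0 = 0 by rewrite /dev f0 /rlin conjc0 !mulr0 addr0 subrr.
pose phi (s : R) := - a * (s * r + ln (1 - s * r)).
have -> : normc (dev z) = normc (dev (0 + 1%:C * z) - dev (0 + 0%:C * z)).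
  by rewrite mul1r mul0r addr0 add0r dev0 subr0.
have -> : - a * (r + ln (1 - r)) = phi 1 - phi 0.
  by rewrite /phi mul1r mul0r subr0 ln1 addr0 mulr0 subr0.
have sr (s : R) : 0 <= s <= 1 -> 0 <= s * r <= r.
  by move=> /andP[s0 s1]; rewrite mulr_ge0//= ler_piMl.
have ns (s : R) : 0 <= s <= 1 -> normc (0 + s%:C * z) = s * r.
  by move=> /andP[s0 s1]; rewrite add0r normcM normc_real ger0_norm.
apply: (@mean_value_ineq _ (fun s => dev (0 + s%:C * z)) (fun s =>
   (A (0 + s%:C * z) - A 0) * z + (B (0 + s%:C * z) - B 0) * conjc z) phi
   (fun s => a * (s * r) / (1 - s * r) * r)) => s s01.
- by apply: rdiff_vdiff; apply: dev_rdiff; rewrite ns//; have := sr _ s01; lra.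
- have sr1 : 0 < 1 - s * r by have := sr _ s01; lra.
  have dln : is_derive (1 - s * r) 1 (@ln R) (1 - s * r)^-1 by exact: is_derive1_ln.
  have aff (b c : R) : is_derive s 1 (fun x => b + x * c) c.
    apply: is_derive_of_epsdelta => e e0; exists 1 => // h _.
    by rewrite (_ : _ - _ = 0) ?normr0 ?mulr_ge0 ?(ltW e0)//; ring.
  have dl : is_derive s 1 (fun x => 1 - x * r) (- r).
    by have := aff 1 (- r); under eq_fun do rewrite mulrN.
  have dr : is_derive s 1 (fun x => x * r) r.
    by have := aff 0 r; under eq_fun do rewrite add0r.
  have := is_deriveZ (- a) (is_deriveD dr (@is_derive1_comp _ (@ln R) (fun x => 1 - x * r) s _ _ dln dl)).
  move=> h; apply: (is_derive_eq h).
  by rewrite /GRing.scale /=; field; lra.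
- rewrite (_ : 0 + _ = s%:C * z) ?add0r//.
  apply: le_trans (ler_normcD _ _) _.
  rewrite !normcM normcJ -mulrDl ler_wpM2r// ler_pdivlMr; last first.
    by have := sr _ s01; lra.
  have E : normc (s%:C * z) = s * r by rewrite -(ns s s01) add0r.
  rewrite [leLHS]mulrC; have := @dAB (s%:C * z); rewrite E; apply.
  by have := sr _ s01; lra.
Qed.

(** This is the origin of the radius: it makes the Lipschitz constant [a r / (1 - r)] of [dev] less
    than [1]. *)
Lemma radius_lt1 (r : R) : 0 <= r -> r < 1 / (1 + a) -> r < 1 /\ a * r < 1 - r.
Proof.
move=> r0; have a1 : 0 < 1 + a by rewrite ltr_pwDl.
rewrite ltr_pdivlMr// => h; have := mulr_ge0 a0 r0; lra.
Qed.

(** If [f z1 = f z2], then [dev z1 - dev z2] is minus the image of [z1 - z2] under the differential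
    at [0], which does not shrink lengths, while [dev] is a strict contraction. *)
Lemma univalent_radius z1 z2 : normc z1 < 1 / (1 + a) -> normc z2 < 1 / (1 + a) ->
  f z1 = f z2 -> z1 = z2.
Proof.
move=> h1 h2 ff; pose r := Num.max (normc z1) (normc z2).
have r0 : 0 <= r by rewrite le_max normc_ge0.
have [|r1 ar] := radius_lt1 r0; first by rewrite gt_max h1.
have := @dev_lipschitz r z1 z2 r1; rewrite !le_max !lexx orbT => /(_ isT isT).
have -> : dev z1 - dev z2 = - rlin (A 0) (B 0) (z1 - z2).
  by rewrite rlinB /dev ff; ring.
rewrite normc_opp => le1; have le2 := normc_rlin_ge (z1 - z2) AB0.
apply/eqP; rewrite -subr_eq0 -normc_eq0 eq_le normc_ge0 andbT leNgt.
apply/negP => pos.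
have : (1 - r) * normc (z1 - z2) <= a * r * normc (z1 - z2).
  by apply: le_trans le1; rewrite ler_wpM2l// subr_ge0 ltW.
by rewrite ler_pM2r// leNgt ar.
Qed.

(* [f z = w] is the fixed point equation [z = L^-1 (w - dev z)], where [L] is the
   differential of [f] at [0]; the right-hand side is a contraction of a slightly
   smaller disk, whose displacement is minimal at the fixed point. *)
Lemma covering_radius w : normc w < 1 + a * ln (a * (1 / (1 + a))) ->
  exists2 z, normc z < 1 / (1 + a) & f z = w.
Proof.
set rho := 1 / (1 + a) => hw; have a1 : 0 < 1 + a by rewrite ltr_pwDl.
have rho0 : 0 < rho by rewrite divr_gt0.
have rhoE : rho * (1 + a) = 1 by rewrite /rho divfK// gt_eqF.
(* Passing from [rho] to [r = rho - e] lowers [r (1 + a)] by [e (1 + a)], at most half of the slack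
   in [hw]; the logarithm only increases, as [1 - r > a rho]. *)
pose e := Num.min (rho / 2) ((1 + a * ln (a * rho) - normc w) / (2 * (1 + a))).
have e0 : 0 < e by rewrite lt_min !divr_gt0 ?subr_gt0 ?mulr_gt0.
have e1 : e <= rho / 2 by rewrite ge_min lexx.
have e2 : e * (2 * (1 + a)) <= 1 + a * ln (a * rho) - normc w.
  by rewrite -ler_pdivlMr ?mulr_gt0// ge_min lexx orbT.
pose r := rho - e; have r0 : 0 < r by rewrite /r; lra.
have rrho : r < rho by rewrite /r; lra.
have rE : r * (1 + a) = 1 - e * (1 + a) by rewrite /r; lra.
have [r1 ar] := radius_lt1 (ltW r0) rrho.
clearbody r; clearbody e.
have wr : normc w - a * (r + ln (1 - r)) < r.
  have : a * ln (a * rho) <= a * ln (1 - r).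
    (* For [a = 0] the logarithm is taken at [0], but its coefficient vanishes. *)
    have [<-|an] := eqVneq 0 a; first by rewrite !mul0r.
    have ap : 0 < a by rewrite lt_neqAle an.
    have arho : 0 < a * rho by exact: mulr_gt0.
    rewrite ler_pM2l// ler_ln ?posrE ?subr_gt0//.
    by rewrite (_ : a * rho = 1 - rho); lra.
  have : 0 < e * (1 + a) by rewrite mulr_gt0.
  lra.
pose T z := rlin_inv (A 0) (B 0) (w - dev z).
have Tr z : normc z <= r -> normc (T z) < r.
  move=> zr; apply: le_lt_trans (normc_rlin_inv_le _ AB0) _.
  apply: le_lt_trans (ler_normcB _ _) _; apply: le_lt_trans wr.
  rewrite lerD2l; apply: le_trans (dev_growth (le_lt_trans zr r1)) _.
  rewrite mulNr lerN2 ler_wpM2l//.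
  set s := normc z in zr *; have s0 : 0 <= s := normc_ge0 z.
  have s1 : 0 < 1 - s by lra.
  have x0 : 0 < (1 - r) / (1 - s) by rewrite divr_gt0// subr_gt0.
  (* From [ln x <= x - 1] one gets [r + ln (1 - r) <= s + ln (1 - s)] for [s <= r]: the bound on
     [dev] is worst on the boundary circle. *)
  have : ln ((1 - r) / (1 - s)) <= (1 - r) / (1 - s) - 1.
    rewrite -[X in ln X](subrK 1) [X in ln X]addrC; apply: le_ln1Dx.
    by rewrite ltrBrDr addNr.
  rewrite ln_div ?posrE ?subr_gt0 ?(le_lt_trans zr r1)//.
  have : (1 - r) / (1 - s) - 1 <= s - r.
    rewrite lerBlDr ler_pdivrMr//; nra.
  lra.
have [||z0 z0r mx] := @EVT_disk R (fun z => - normc (T z - z) ^+ 2) r.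
- exact: ltW.
- move=> z zr; have cdev := rdiff_ccont (dev_rdiff (le_lt_trans zr r1)).
  have cd : ccont (fun x => w + (-1) * dev x) z.
    exact: ccontD (ccont_cst _ _) (ccontM (ccont_cst _ _) cdev).
  have cT : ccont (fun x => T x + (-1) * x) z.
    apply: ccontD; last exact: ccontM (ccont_cst _ _) (ccont_id z).
    have := ccontM (ccontD (ccontM (ccont_cst (conjc (A 0)) z) cd)
      (ccontM (ccont_cst (- B 0) z) (ccontJ cd)))
      (ccont_cst (A 0 * conjc (A 0) - B 0 * conjc (B 0))^-1 z).
    by apply: eq_small => t; rewrite /T /rlin_inv !mulN1r !mulNr.
  have := ccontM (ccont_cst (-1) z) (ccontM cT (ccontJ cT)).
  by apply: eq_small => t; rewrite !mulcJ !mulN1r !rmorphN.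
exists z0; first exact: le_lt_trans rrho.
have Tz0 : T z0 = z0.
  apply/eqP; rewrite -subr_eq0 -normc_eq0 eq_le normc_ge0 andbT leNgt.
  apply/negP => pos; have Tz0r := Tr _ z0r.
  (* [T z0] is itself a competitor, and its displacement is smaller by the factor
     [a r / (1 - r) < 1]. *)
  have := mx _ (ltW Tz0r); rewrite lerN2 -ler_normc_sqr ?normc_ge0//.
  have -> : T (T z0) - T z0 = rlin_inv (A 0) (B 0) (dev z0 - dev (T z0)).
    by rewrite -rlin_invB; congr rlin_inv; ring.
  move=> le1; have le2 := le_trans le1 (normc_rlin_inv_le _ AB0).
  have := dev_lipschitz r1 z0r (ltW Tz0r); rewrite [normc (z0 - _)]normc_distC.
  have : (1 - r) * normc (T z0 - z0) <= (1 - r) * normc (dev z0 - dev (T z0)).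
    by rewrite ler_wpM2l// subr_ge0 ltW.
  move=> h1 h2; have := le_trans h1 h2.
  by rewrite ler_pM2r// leNgt ar.
have h := rlin_invK (w - dev z0) AB0; rewrite -/(T z0) Tz0 in h.
have -> : f z0 = dev z0 + rlin (A 0) (B 0) z0 by rewrite /dev subrK.
by rewrite h addrC subrK.
Qed.

End Harmonic.
End Univalence.

(** * Harmonic mappings *)

Section HarmonicMapping.
Variable R : realType.
Variables f h g : R[i] -> R[i].
Hypothesis h_analytic : analytic_on (disk 1) h.
Hypothesis g_analytic : analytic_on (disk 1) g.
Hypothesis f_decomp : forall z, disk 1 z -> f z = h z + conjc (g z).
Hypothesis f_C2 : C2_on (disk 1) f.

Lemma disk_nbhs (z t : R[i]) : normc t < 1 - normc z -> disk 1 (z + t).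
Proof.
by move=> tz; apply: le_lt_trans (ler_normcD _ _) _; rewrite -ltrBrDl.
Qed.

(** The differential of [f] is read off from [h + conjc g], and its coefficients are unique by
    [rdiff_dz]. *)
Lemma rdiff_decomp (z : R[i]) : normc z < 1 ->
  rdiff h z (dz f z) 0 /\ rdiff g z (conjc (dzbar f z)) 0.
Proof.
move=> z1; have [a ha] := rdiff_of_derivable (h_analytic z1).
have [b hb] := rdiff_of_derivable (g_analytic z1).
have d0 : 0 < 1 - normc z by rewrite subr_gt0.
have fE t : normc t < 1 - normc z -> h (z + t) + conjc (g (z + t)) = f (z + t).
  by move=> /disk_nbhs/f_decomp ->.
have := rdiff_ext d0 fE (rdiffD ha (rdiffJ hb)).
rewrite conjc0 addr0 add0r => /rdiff_dz[-> ->].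
by rewrite conjcK.
Qed.

Lemma rdiff_harmonic (z : R[i]) : normc z < 1 -> rdiff f z (dz f z) (dzbar f z).
Proof.
case: f_C2 => [C1 _ _] z1.
have d0 : 0 < 1 - normc z by rewrite subr_gt0.
exact: C1_rdiff d0 (@disk_nbhs z) C1.
Qed.

(** C2 regularity makes the derivative of [h + c g] differentiable in the real sense only;
    [expand2_primitive] upgrades this to a complex expansion. *)
Lemma expand2_decomp (c z : R[i]) : normc z < 1 -> expand2 (fun x => h x + c * g x) z.
Proof.
move=> z1; have d0 : 0 < 1 - normc z by rewrite subr_gt0.
case: f_C2 => [_ Cx Cy].
have rx := C1_rdiff d0 (@disk_nbhs z) Cx; have ry := C1_rdiff d0 (@disk_nbhs z) Cy.
have rA := rdiffZ 2^-1 (rdiffD rx (rdiffZ (-1) (rdiffZ 'i ry))).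
have rB := rdiffZ 2^-1 (rdiffD rx (rdiffZ 'i ry)).
apply: (@expand2_primitive _ _ (fun x => dz f x + c * conjc (dzbar f x)) _ _ _ _ d0).
  move=> t /disk_nbhs/rdiff_decomp[rh rg].
  by have := rdiffD rh (rdiffZ c rg); rewrite mulr0 addr0.
apply: rdiffD (rdiffZ c (rdiffJ rB)).
by apply: eq_rdiff rA => x; rewrite /dz mulN1r.
Qed.

(** The unimodular [c] depends on the point [z] under study: it aligns the increments of the two
    derivatives there. The bound [1 <= |F 0|] holds for every such [c], by the reverse triangle
    inequality. *)
Lemma harmonic_deviation (M : R) : 1 <= M -> lambda_min f 0 = 1 ->
  (forall z, disk 1 z -> normc (dz f z) + normc (dzbar f z) <= M) ->
  forall z, normc z < 1 ->
    (1 - normc z) * (normc (dz f z - dz f 0) + normc (dzbar f z - dzbar f 0)) <=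
    (M - M^-1) * normc z.
Proof.
move=> M1 l0 fM z z1; have M0 : 0 < M by lra.
have [c c1 cE] := normc_align (dz f z - dz f 0) (conjc (dzbar f z - dzbar f 0)).
pose F x := dz f x + c * conjc (dzbar f x).
have rP x : normc x < 1 -> rdiff (fun x => h x + c * g x) x (F x) 0.
  by move=> /rdiff_decomp[rh rg]; have := rdiffD rh (rdiffZ c rg);
    rewrite mulr0 addr0.
have FM x : normc x < 1 -> normc (F x) <= M.
  move=> x1; apply: le_trans (fM _ x1); apply: le_trans (ler_normcD _ _) _.
  by rewrite normcM c1 mul1r normcJ.
have := schwarz_pick_primitive M0 rP (@expand2_decomp c) FM z1.
have -> : normc (F z - F 0) =
    normc (dz f z - dz f 0) + normc (dzbar f z - dzbar f 0).
  by rewrite -(normcJ (dzbar f z - _)) -cE; congr normc; rewrite /F rmorphB; ring.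
have F0 : 1 <= normc (F 0).
  rewrite -l0 /lambda_min ler_norml /F.
  have := ler_sub_normcD (dz f 0) (c * conjc (dzbar f 0)).
  have := ler_sub_normcD (c * conjc (dzbar f 0)) (dz f 0).
  by rewrite [c * _ + _]addrC normcM c1 normcJ mul1r; lra.
set X := _ + _ => sp; have z0 := normc_ge0 z.
have : normc z * (M ^+ 2 - normc (F 0) ^+ 2) <= normc z * (M ^+ 2 - 1).
  by rewrite ler_wpM2l//; nra.
move=> /(le_trans sp) {}sp; rewrite -(ler_pM2l M0).
rewrite (_ : M * ((M - M^-1) * _) = normc z * (M ^+ 2 - 1)).
  by rewrite mulrA.
by field; rewrite gt_eqF.
Qed.

End HarmonicMapping.

Theorem theorem2 (R : realType) (K K' lam : R) (f h g : R[i] -> R[i])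
  (K_ge1 : 1 <= K) (K'_ge0 : 0 <= K')
  (h_analytic : analytic_on (disk 1) h) (g_analytic : analytic_on (disk 1) g)
  (g0 : g 0 = 0)
  (f_decomp : forall z, disk 1 z -> f z = h z + (g z)^*)
  (f_harmonic : harmonic_on (disk 1) f)
  (f_elliptic : elliptic K K' f)
  (f0 : f 0 = 0)
  (lam_f0 : lambda_min f 0 = 1)
  (lam_f : forall z, disk 1 z -> lambda_min f z <= lam) :
  let S := K * lam + Num.sqrt (K ^+ 2 * lam ^+ 2 + 4 * K') in
  let r1 := 1 / (1 + K * lam + 2 * (K' - 1) / S) in
  let sigma1 := 1 + (K * lam + 2 * (K' - 1) / S) *
                    ln (K * lam * r1 + 2 * (K' - 1) * r1 / S) in
  {in disk r1 &, injective f} /\ disk sigma1 `<=` f @` disk r1.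
Proof.
move=> S r1 sigma1.
have [C2 _] := f_harmonic; have [C1 _ _] := C2; have [_ _ _ fK] := f_elliptic.
have zero_in : disk 1 (0 : R[i]) by rewrite /disk /= expr0n addr0 sqrtr0.
have lam1 : 1 <= lam by rewrite -lam_f0; exact: lam_f.
pose k := K * lam; have k1 : 1 <= k by rewrite -[leLHS]mul1r ler_pM.
have s2 : Num.sqrt (K ^+ 2 * lam ^+ 2 + 4 * K') ^+ 2 = k ^+ 2 + 4 * K'.
  by rewrite sqr_sqrtr -?exprMn// addr_ge0 ?sqr_ge0// mulr_ge0.
have sk : k <= Num.sqrt (K ^+ 2 * lam ^+ 2 + 4 * K').
  rewrite -(@ler_pXn2r _ 2) ?nnegrE ?sqrtr_ge0//; last lra.
  by rewrite s2 lerDl mulr_ge0.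
pose M := S / 2.
have SM : S = 2 * M by rewrite /M; field.
have M2 : M ^+ 2 = k * M + K'.
  rewrite (_ : M ^+ 2 = (k ^+ 2 + 2 * k * (S - k) + (S - k) ^+ 2) / 4).
    have -> : S - k = Num.sqrt (K ^+ 2 * lam ^+ 2 + 4 * K') by rewrite /S addrC addKr.
    by rewrite s2 /M /S -/k; field.
  by rewrite /M; field.
have kM : k <= M by rewrite /M /S -/k; lra.
have M0 : 0 < M by lra.
have Mle := elliptic_dilatation_le K_ge1 M0 kM M2 C1 fK lam_f.
(* Eliminating [K'] by [M2] gives [2 (K' - 1) / S = M - k - 1/M]. *)
have aE : k + 2 * (K' - 1) / S = M - M^-1.
  have -> : K' = M ^+ 2 - k * M by rewrite M2; ring.
  by rewrite SM; field; rewrite gt_eqF.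
have a0 : 0 <= M - M^-1.
  by rewrite subr_ge0 (@le_trans _ _ 1)// ?invf_le1//; lra.
have dev := harmonic_deviation h_analytic g_analytic f_decomp C2 _ lam_f0 Mle.
have {}dev := dev (le_trans k1 kM).
have df := rdiff_harmonic C2.
have r1E : r1 = 1 / (1 + (M - M^-1)) by rewrite /r1 -addrA -/k aE.
have sigma1E : sigma1 = 1 + (M - M^-1) * ln ((M - M^-1) * (1 / (1 + (M - M^-1)))).
  rewrite /sigma1 -/k aE -r1E; congr (_ + _ * ln _).
  by rewrite -aE /k; ring.
split=> [z1 z2|w].
  rewrite !inE /disk /= r1E => h1 h2.
  exact: (univalent_radius a0 df dev lam_f0 h1 h2).
rewrite /disk /= sigma1E r1E => hw.
by have [z zr fz] := covering_radius a0 df dev lam_f0 f0 hw; exists z.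
Qed.
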